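(* Let $P\bowtie G$ be a Zappa-Szép product of a semigroup $P$ and a group $G$, let $\mathcal{A}$ be a unital C*-algebra, let $X$ be a product system over $P$ with coefficient $\mathcal{A}$, and let $(X,G,\beta)$ be a Zappa-Szép system. Then (with $\cong$ denoting $*$-isomorphism of C*-algebras) (i) $\mathcal{T}_{X\bowtie G}\cong\mathcal{T}_X\bowtie G$; and (ii) $\mathcal{T}_{X\bowtie G}\cong\mathcal{T}_X\bowtie G\cong\mathcal{T}_{X\widetilde\bowtie G}$ provided that $(X,G,\beta)$ is homogeneous.
   Context: Semigroups and groups are discrete, and every semigroup has an identity, written $e$ (the identity of $G$ is also written $e$). Zappa-Szép product. One is given a left action $G\times P\to P$, $(g,p)\mapsto g\cdot p$, and a map $P\times G\to G$, $(p,g)\mapsto g|_p$, such that for all $g,h\in G$, $p,q\in P$: $e\cdot p=p$; $(gh)\cdot p=g\cdot(h\cdot p)$; $g\cdot e=e$; $g|_e=g$; $g\cdot(pq)=(g\cdot p)(g|_p\cdot q)$; $g|_{pq}=(g|_p)|_q$; $e|_p=e$; $(gh)|_p=g|_{h\cdot p}\,h|_p$. Then $P\bowtie G=P\times G$ with product $(p,g)(q,h)=(p(g\cdot q),\,g|_q h)$ is a semigroup with identity $(e,e)$. Product system. An $\mathcal{A}$-correspondence is a right Hilbert $\mathcal{A}$-module with a left action of $\mathcal{A}$ by adjointable operators. A product system over a semigroup $P$ with coefficient $\mathcal{A}$ is $X=\bigsqcup_{p\in P}X_p$, with each $X_p$ an $\mathcal{A}$-correspondence, with an associative multiplication $X_p\times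 X_q\to X_{pq}$ such that (1) $X_e=\mathcal{A}$ as an $\mathcal{A}$-correspondence; (2) for all $p,q\in P$ the multiplication extends to a unitary $M_{p,q}:X_p\otimes X_q\to X_{pq}$ (interior tensor product over $\mathcal{A}$); (3) the left and right actions of $\mathcal{A}$ on $X_p$ coincide with the multiplications $X_e\times X_p\to X_p$ and $X_p\times X_e\to X_p$. Zappa-Szép action of $G$ on $X$: a collection $\beta=\{\beta_g\}_{g\in G}$ of maps on $X$ such that (A1) for each $p\in P$, $g\in G$, $\beta_g$ restricts to a $\mathbb{C}$-linear map $X_p\to X_{g\cdot p}$; (A2) $\beta_g\circ\beta_h=\beta_{gh}$; (A3) $\beta_e$ is the identity; (A4) each $\beta_g$ is a $*$-automorphism of $X_e=\mathcal{A}$; (A5) $\beta_g(xy)=\beta_g(x)\beta_{g|_p}(y)$ for $x\in X_p$, $y\in X_q$; (A6) $\langle\beta_g(x),\beta_g(y)\rangle=\beta_{g|_p}(\langle x,y\rangle)$ for $x,y\in X_p$. The triple $(X,G,\beta)$ is then called a Zappa-Szép system; it is homogeneous if $g\cdot p=p$ for all $g\in G$, $p\in P$. The product system $X\bowtie G$ over $P\bowtie G$ with coefficient $\mathcal{A}$: its fibre over $(p,g)$ is $Y_{(p,g)}=\{x\otimes g:x\in X_p\}$ with $a(x\otimes g)=ax\otimes g$, $(x\otimes g)a=x\beta_g(a)\otimes g$, $\langle x\otimes g,y\otimes g\rangle=\beta_{g^{-1}}(\langle x,y\rangle)$, and multiplication $(x\otimes g)(y\otimes h)=x\beta_g(y)\otimes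 g|_q h$ for $x\in X_p$, $y\in X_q$; $Y_{(e,e)}$ is identified with $\mathcal{A}$ via $a\otimes e\leftrightarrow a$. The product system $X\widetilde\bowtie G$ over $P$ (homogeneous case). Let $\mathfrak{A}=\mathcal{A}\rtimes_\beta G$ be the universal (full) crossed product, generated by $\mathcal{A}$ and unitaries $u_g$ with $u_ga=\beta_g(a)u_g$. For $p\in P$ put $Z_p^0=c_{00}(G,X_p)=\operatorname{span}\{x\otimes g:x\in X_p,g\in G\}$ with $(au_h)(x\otimes g)=a\beta_h(x)\otimes h|_p g$, $(x\otimes g)(au_h)=x\beta_g(a)\otimes gh$, $\langle x\otimes g,y\otimes h\rangle=\beta_{g^{-1}}(\langle x,y\rangle)u_{g^{-1}h}$, and let $Z_p$ be its completion in $\|\xi\|=\|\langle\xi,\xi\rangle\|^{1/2}$, an $\mathfrak{A}$-correspondence. $X\widetilde\bowtie G=\bigsqcup_pZ_p$ is the product system over $P$ with coefficient $\mathfrak{A}$ whose multiplication is given by $(x\otimes g)(y\otimes h)=x\beta_g(y)\otimes g|_q h$ ($x\in X_p$, $y\in X_q$), with $Z_e$ identified with $\mathfrak{A}$ via $a\otimes g\mapsto au_g$. A (Toeplitz) representation of a product system $X$ over $P$ on a C*-algebra $\mathcal{B}$ is a family $\psi=(\psi_p)_{p\in P}$ of linear maps $\psi_p:X_p\to\mathcal{B}$ such that $\psi_e$ is a $*$-homomorphism, $\psi_p(x)\psi_q(y)=\psi_{pq}(xy)$ for $x\in X_p,y\in X_q$, and $\psi_p(x)^*\psi_p(y)=\psi_e(\langle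 x,y\rangle)$ for $x,y\in X_p$. $\mathcal{T}_X$ denotes the universal C*-algebra for representations of $X$: it is generated by the image of a universal representation $i_X$, and every representation $\psi$ factors as $\psi=\psi_*\circ i_X$ for a $*$-homomorphism $\psi_*:\mathcal{T}_X\to C^*(\psi(X))$. A covariant representation of $(X,G,\beta)$ on a unital C*-algebra $\mathcal{B}$ is a pair $(\psi,U)$ of a representation $\psi$ of $X$ on $\mathcal{B}$ and a unitary representation $U$ of $G$ on $\mathcal{B}$ with $U_g\psi_p(x)=\psi_{g\cdot p}(\beta_g(x))U_{g|_p}$ for all $p\in P$, $g\in G$, $x\in X_p$. $\mathcal{T}_X\bowtie G$ denotes the universal C*-algebra generated by covariant representations of $(X,G,\beta)$.
   Formalization: T_X⋈G is taken to be generated by the products ψ_p(x)U_g, with its universal property stated on them (equivalently, ψ_e unital); generated by ψ and U separately with ψ_e not unital it has an extra summand C*(G), and (i) fails, e.g. for A=C with P and G trivial. *)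

(* Defs.v *)
From HB Require Import structures.
From mathcomp Require Import all_boot all_order all_algebra.
From mathcomp Require Import complex.
From mathcomp Require Import all_classical all_reals all_analysis.
Set Implicit Arguments. Unset Strict Implicit. Unset Printing Implicit Defensive.
Import Order.TTheory GRing.Theory Num.Theory.
Import numFieldNormedType.Exports.
Local Open Scope classical_set_scope.
Local Open Scope ring_scope.

Record cstarAlg (R : realType) := CstarAlg {
  cs_sort :> completeNormedModType R[i];
  cmul : cs_sort -> cs_sort -> cs_sort;
  adj : cs_sort -> cs_sort;
  cmulA : associative cmul;
  cmulDl : left_distributive cmul +%R;
  cmulDr : right_distributive cmul +%R;
  cmulZl : forall (c : R[i]) a b, cmul (c *: a) b = c *: cmul a b;
  cmulZr : forall (c : R[i]) a b, cmul a (c *: b) = c *: cmul a b;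
  adjK : involutive adj;
  adjD : {morph adj : a b / a + b};
  adjZ : forall (c : R[i]) a, adj (c *: a) = c^* *: adj a;
  adjM : forall a b, adj (cmul a b) = cmul (adj b) (adj a);
  normM_le : forall a b, `|cmul a b| <= `|a| * `|b|;
  normC : forall a, `|cmul (adj a) a| = `|a| ^+ 2 }.

Notation "a ** b" := (cmul a b) (at level 40, left associativity) : ring_scope.

Record ucstarAlg (R : realType) := UcstarAlg {
  ucs_alg :> cstarAlg R;
  cone : ucs_alg;
  cmul1l : left_id cone (@cmul R ucs_alg);
  cmul1r : right_id cone (@cmul R ucs_alg) }.
Arguments cone {R} _.

Section CstarDefs.
Context {R : realType}.

Definition is_star_hom (A B : cstarAlg R) (f : A -> B) : Prop :=
  [/\ linear f,
      forall a b, f (a ** b) = f a ** f b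
    & forall a, f (adj a) = adj (f a)].

Definition cstar_iso (A B : cstarAlg R) : Prop :=
  exists f : A -> B, is_star_hom f /\ bijective f.

Definition is_cstar_sub (A : cstarAlg R) (D : set A) : Prop :=
  [/\ closed D, D 0,
      forall (c : R[i]) a b, D a -> D b -> D (c *: a + b),
      forall a b, D a -> D b -> D (a ** b)
    & forall a, D a -> D (adj a)].

Definition generates (A : cstarAlg R) (S : set A) : Prop :=
  forall D : set A, is_cstar_sub D -> S `<=` D -> D = setT.

Definition lin_span (V : lmodType R[i]) (S : set V) : set V :=
  [set v | exists n (c : 'I_n -> R[i]) (s : 'I_n -> V),
             (forall k, S (s k)) /\ v = \sum_(k < n) c k *: s k].

End CstarDefs.

Record hilbertModule (R : realType) (A : cstarAlg R) := HilbertModule {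
  hm_sort :> completeNormedModType R[i];
  ract : hm_sort -> A -> hm_sort;
  inner : hm_sort -> hm_sort -> A;
  ractDl : forall x y a, ract (x + y) a = ract x a + ract y a;
  ractDr : forall x a b, ract x (a + b) = ract x a + ract x b;
  ractZl : forall (c : R[i]) x a, ract (c *: x) a = c *: ract x a;
  ractZr : forall (c : R[i]) x a, ract x (c *: a) = c *: ract x a;
  ractM : forall x a b, ract x (a ** b) = ract (ract x a) b;
  innerDr : forall x y z, inner x (y + z) = inner x y + inner x z;
  innerZr : forall (c : R[i]) x y, inner x (c *: y) = c *: inner x y;
  inner_ract : forall x y a, inner x (ract y a) = inner x y ** a;
  adj_inner : forall x y, adj (inner x y) = inner y x;
  inner_pos : forall x, exists b : A, inner x x = adj b ** b;
  norm_inner : forall x, `|x| ^+ 2 = `|inner x x| }.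

Record correspondence (R : realType) (A : cstarAlg R) := Correspondence {
  corr_hm :> hilbertModule A;
  lact : A -> corr_hm -> corr_hm;
  lactDl : forall a b x, lact (a + b) x = lact a x + lact b x;
  lactDr : forall a x y, lact a (x + y) = lact a x + lact a y;
  lactZl : forall (c : R[i]) a x, lact (c *: a) x = c *: lact a x;
  lactZr : forall (c : R[i]) a x, lact a (c *: x) = c *: lact a x;
  lactM : forall a b x, lact (a ** b) x = lact a (lact b x);
  lact_adj : forall a x y, inner (lact a x) y = inner x (lact (adj a) y) }.

Section Tensor.
Context {R : realType} {A : cstarAlg R}.

Definition is_unitary (E F : hilbertModule A) (M : E -> F) : Prop :=
  exists N : F -> E,
    [/\ forall x y, inner (M x) y = inner x (N y), cancel M N & cancel N M].

(* The interior tensor product is the separated completion of the algebraic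
   tensor product for the semi-inner product below; balancedness
   [t (x . a) y = t x (a . y)] and [t x (y . a) = t x y . a] follow from the
   inner product formula. *)
Record is_interior_tensor (E : hilbertModule A) (F : correspondence A)
    (T : hilbertModule A) (t : E -> F -> T) : Prop := {
  tensor_linl : forall y, linear (fun x => t x y);
  tensor_linr : forall x, linear (t x);
  tensor_inner : forall x y x' y',
    inner (t x y) (t x' y') = inner y (lact (inner x x') y');
  tensor_dense : dense (lin_span [set z | exists x y, z = t x y]) }.

Definition tot (P : Type) (X : P -> correspondence A) (p : P) (x : X p)
  : {p : P & X p} := existT (fun p => X p : Type) p x.

End Tensor.

Record productSystem (R : realType) (P : monoidType) (A : cstarAlg R) :=
  ProductSystem {
  fibre :> P -> correspondence A;
  psmul : forall p q : P, fibre p -> fibre q -> fibre (p * q)%g;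
  psid : A -> fibre 1%g;
  psid_linear : linear psid;
  psid_bij : bijective psid;
  psid_lact : forall a b, psid (a ** b) = lact a (psid b);
  psid_ract : forall a b, psid (a ** b) = ract (psid a) b;
  psid_inner : forall a b, inner (psid a) (psid b) = adj a ** b;
  psmulA : forall (p q r : P) (x : fibre p) (y : fibre q) (z : fibre r),
    tot (psmul (psmul x y) z) = tot (psmul x (psmul y z));
  psmul_unitary : forall p q : P,
    exists (T : hilbertModule A) (t : fibre p -> fibre q -> T)
           (M : T -> fibre (p * q)%g),
      [/\ is_interior_tensor t, is_unitary M
        & forall x y, M (t x y) = psmul x y];
  psmul_idl : forall (p : P) a (x : fibre p),
    tot (psmul (psid a) x) = tot (lact a x);
  psmul_idr : forall (p : P) a (x : fibre p),
    tot (psmul x (psid a)) = tot (ract x a) }.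
Arguments psid {R P A} _ _.

Record zappaSzep (P : monoidType) (G : groupType) := ZappaSzep {
  zact : G -> P -> P;
  zres : G -> P -> G;  (* [zres g p] is g|_p *)
  zact1g : forall p, zact 1%g p = p;
  zactM : forall g h p, zact (g * h)%g p = zact g (zact h p);
  zact_1 : forall g, zact g 1%g = 1%g;
  zres_1 : forall g, zres g 1%g = g;
  zact_mul : forall g p q,
    zact g (p * q)%g = (zact g p * zact (zres g p) q)%g;
  zres_mul : forall g p q, zres g (p * q)%g = zres (zres g p) q;
  zres1g : forall p, zres 1%g p = 1%g;
  zresM : forall g h p, zres (g * h)%g p = (zres g (zact h p) * zres h p)%g }.

Definition homogeneous (P : monoidType) (G : groupType) (D : zappaSzep P G) :=
  forall g p, zact D g p = p.

(* An alias, since [P * G] itself carries the direct product structure. *)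
Definition bowtie (P : monoidType) (G : groupType) (D : zappaSzep P G) : Type :=
  (P * G)%type.

Section BowtieMonoid.
Variables (P : monoidType) (G : groupType) (D : zappaSzep P G).

Definition bowtie_mul (s t : bowtie D) : bowtie D :=
  (s.1 * zact D s.2 t.1, zres D s.2 t.1 * t.2)%g.

Lemma bowtie_mulA : associative bowtie_mul.
Proof.
move=> [p g] [q h] [r k]; rewrite /bowtie_mul /=; congr pair.
  by rewrite zact_mul zactM mulgA.
by rewrite zres_mul zresM !mulgA.
Qed.

Lemma bowtie_mul1g : left_id ((1%g, 1%g) : bowtie D) bowtie_mul.
Proof. by move=> [p g]; rewrite /bowtie_mul /= zact1g zres1g !mul1g. Qed.

Lemma bowtie_mulg1 : right_id ((1%g, 1%g) : bowtie D) bowtie_mul.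
Proof. by move=> [p g]; rewrite /bowtie_mul /= zact_1 zres_1 !mulg1. Qed.

HB.instance Definition _ := Choice.copy (bowtie D) (P * G)%type.
HB.instance Definition _ :=
  isMonoid.Build (bowtie D) bowtie_mulA bowtie_mul1g bowtie_mulg1.

End BowtieMonoid.

(* [zbeta] is the family of restrictions X_p -> X_(g.p), and [zalpha g] is
   the automorphism that beta_g induces on A through the identification
   [psid] of A with X_e (see [zalphaE]). *)
Record zsAction (R : realType) (P : monoidType) (G : groupType)
    (D : zappaSzep P G) (A : cstarAlg R) (X : productSystem P A) := ZsAction {
  zbeta : forall (g : G) (p : P), X p -> X (zact D g p);
  zalpha : G -> A -> A;
  zbeta_linear : forall g p, linear (@zbeta g p);
  zbetaM : forall g h p (x : X p),
    tot (zbeta g (zbeta h x)) = tot (zbeta (g * h)%g x);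
  zbeta1 : forall p (x : X p), tot (zbeta 1%g x) = tot x;
  zalphaE : forall g a, tot (zbeta g (psid X a)) = tot (psid X (zalpha g a));
  zalpha_hom : forall g, is_star_hom (zalpha g);
  zalpha_bij : forall g, bijective (zalpha g);
  zbeta_psmul : forall g p q (x : X p) (y : X q),
    tot (zbeta g (psmul x y)) = tot (psmul (zbeta g x) (zbeta (zres D g p) y));
  zbeta_inner : forall g p (x y : X p),
    inner (zbeta g x) (zbeta g y) = zalpha (zres D g p) (inner x y) }.

Section CstarTheory.
Context {R : realType}.
Local Notation C := R[i].

Section Basic.
Variable A : cstarAlg R.
Implicit Types a b : A.

Lemma cmul0r a : a ** 0 = 0 :> A.
Proof. by rewrite -[X in a ** X](scale0r a) cmulZr scale0r. Qed.

Lemma cmul0l a : 0 ** a = 0 :> A.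
Proof. by rewrite -[X in X ** a](scale0r a) cmulZl scale0r. Qed.

Lemma cmulNr a b : a ** (- b) = - (a ** b).
Proof. by rewrite -scaleN1r cmulZr scaleN1r. Qed.

Lemma cmulNl a b : (- a) ** b = - (a ** b).
Proof. by rewrite -scaleN1r cmulZl scaleN1r. Qed.

Lemma cmulBr a b c : a ** (b - c) = a ** b - a ** c.
Proof. by rewrite cmulDr cmulNr. Qed.

Lemma cmulBl a b c : (a - b) ** c = a ** c - b ** c.
Proof. by rewrite cmulDl cmulNl. Qed.

Lemma adj0 : adj (0 : A) = 0.
Proof. by apply: (addrI (adj 0)); rewrite -adjD !addr0. Qed.

Lemma adjN a : adj (- a) = - adj a.
Proof. by apply: (addrI (adj a)); rewrite -adjD !subrr adj0. Qed.

Lemma adjB a b : adj (a - b) = adj a - adj b.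
Proof. by rewrite adjD adjN. Qed.

Lemma norm_adj a : `|adj a| = `|a|.
Proof.
suff le b : `|b| <= `|adj b|.
  by apply/eqP; rewrite eq_le le andbT -{2}(adjK a) le.
have [->|nz] := eqVneq b 0; first by rewrite normr0.
have n0 : 0 < `|b| by rewrite normr_gt0.
by rewrite -(ler_pM2r n0) -expr2 -normC normM_le.
Qed.

End Basic.

Lemma small_eq0 (V : normedModType C) (v : V) (K : C) :
  0 <= K -> (forall e, 0 < e -> `|v| <= K * e) -> v = 0.
Proof.
move=> K0 h; apply/eqP; apply: contraT => nz.
have n0 : 0 < `|v| by rewrite normr_gt0.
have K1 : 0 < K + 1 by rewrite ltr_wpDl.
have := h (`|v| / (K + 1)) (divr_gt0 n0 K1).
rewrite mulrCA ler_pMr // ler_pdivlMr // mul1r => le.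
by have := lt_le_trans (ltr_pwDr ltr01 (lexx K)) le; rewrite ltxx.
Qed.

Lemma geometric_small (r e : C) : 0 <= r < 1 -> 0 < e ->
  exists N, forall n, (N <= n)%N -> r ^+ n < e.
Proof.
case/andP=> r0 r1 e0.
have rE : r = (complex.Re r)%:C%C by rewrite RRe_real // ger0_real.
have eE : e = (complex.Re e)%:C%C by rewrite RRe_real // gtr0_real.
move: r0 r1 e0; rewrite rE eE.
move: (complex.Re r) (complex.Re e) => s t {rE eE}.
rewrite -[0]/(0%:C%C) -[1]/(1%:C%C) !lecR !ltcR => s0 s1 t0.
have cvs : (fun n => s ^+ n) @ \oo --> (0 : R).
  by apply: cvg_expr; rewrite ger0_norm.
have /cvgrPdist_lt/(_ t t0) [N _ hN] := cvs.
exists N => n le; rewrite -rmorphXn ltcR.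
by have := hN n le; rewrite /= sub0r normrN ger0_norm ?exprn_ge0.
Qed.

Section Sqrt.
Variable A : ucstarAlg R.
Implicit Types a b : A.

Lemma adj_cone : adj (cone A) = cone A.
Proof. by rewrite -[LHS]cmul1l -{1}(adjK (cone A)) -adjM cmul1l adjK. Qed.

Lemma norm_cone_le1 : `|cone A| <= 1.
Proof.
have [h|nz] := eqVneq (`|cone A|) 0; first by rewrite h ler01.
have := normC (cone A); rewrite adj_cone cmul1l expr2 => h.
by rewrite (_ : `|cone A| = 1) //; apply: (mulfI nz); rewrite mulr1.
Qed.

Lemma isometry_norm_le1 (v : A) : adj v ** v = cone A -> `|v| <= 1.
Proof.
move=> h; have := normC v; rewrite h => n.
by rewrite -(@expr_le1 _ 2) // -n norm_cone_le1.
Qed.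

(* A self-adjoint strict contraction is the real part of a unitary: the square
   root of [1 - h ^ 2] is [1 - y], with [y] the fixed point of the contraction
   [y |-> (h ^ 2 + y ^ 2) / 2]. *)
Lemma sqrt_exists (h : A) : adj h = h -> `|h| < 1 ->
  exists c : A, [/\ adj c = c, c ** h = h ** c & h ** h + c ** c = cone A].
Proof.
move=> hs h1.
pose F (y : A) := (2^-1 : C) *: (h ** h + y ** y).
pose s : C := `|h| ^+ 2.
have s0 : 0 <= s by rewrite exprn_ge0.
have s1 : s < 1 by rewrite exprn_ilt1.
pose r : C := (1 + s) / 2.
have r0 : 0 <= r by rewrite divr_ge0 // addr_ge0.
have r1 : r < 1 by rewrite ltr_pdivrMr // mul1r -[2]/(1+1) ltrD2l.
have rs : s + r ^+ 2 <= r *+ 2.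
  have -> : r *+ 2 = 1 + s by rewrite -mulr_natr /r mulfVK ?pnatr_eq0.
  rewrite addrC lerD2r; exact: exprn_ile1 (ltW r1).
have n2 : `|2^-1 : C| = 2^-1 by rewrite ger0_norm ?invr_ge0.
have normhh : `|h ** h| = s by rewrite -{1}hs normC.
have Fball y : `|y| <= r -> `|F y| <= r.
  move=> yr; rewrite /F normrZ n2 mulrC ler_pdivrMr // mulr_natr.
  apply: le_trans rs; apply: le_trans (ler_normD _ _) _; rewrite normhh lerD2l.
  by apply: le_trans (normM_le _ _) _; rewrite expr2 ler_pM.
have Flip y z : `|y| <= r -> `|z| <= r -> `|F y - F z| <= r * `|y - z|.
  move=> yr zr.
  have -> : F y - F z = (2^-1 : C) *: (y ** (y - z) + (y - z) ** z).
    rewrite /F -scalerBr; congr (_ *: _).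
    rewrite cmulBr cmulBl addrA subrK opprD addrACA subrr add0r.
    by [].
  rewrite normrZ n2 mulrC ler_pdivrMr //.
  apply: le_trans (ler_normD _ _) _; rewrite -mulrA [_ * 2]mulrC mulrA mulr_natr.
  rewrite mulr2n mulrDl lerD //.
    by apply: le_trans (normM_le _ _) _; rewrite ler_wpM2r.
  by apply: le_trans (normM_le _ _) _; rewrite mulrC ler_wpM2r.
pose y n := iter n F 0.
have yball n : `|y n| <= r.
  by elim: n => [|n IH]; rewrite /y /= ?normr0 //; apply: Fball.
have ycauchy n k : `|y (n + k)%N - y n| <= r ^+ n.
  elim: n => [|n IH].
    by rewrite add0n subr0 expr0; apply: le_trans (yball k) (ltW r1).
  rewrite addSn /y /= exprS; apply: le_trans (Flip _ _ (yball _) (yball _)) _.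
  by rewrite ler_wpM2l.
have [l ly] : exists l : A, forall e, 0 < e ->
    exists N, forall n, (N <= n)%N -> `|l - y n| < e.
  have /cauchy_cvg yl : cauchy (y @ \oo).
    apply: cauchy_exP => _/posnumP[e].
    have [|N hN] := @geometric_small r e%:num _ (gt0 e); first by rewrite r0 r1.
    exists (y N); exists N => // n /= le; rewrite -ball_normE /ball_ /=.
    rewrite distrC -(subnKC le); apply: le_lt_trans (ycauchy _ _) _; exact: hN.
  exists (lim (y @ \oo)) => e e0.
  have /cvgrPdist_lt/(_ e e0) [N _ hN] := yl.
  by exists N => n; apply: hN.
have lball : `|l| <= r.
  rewrite real_leNgt ?normr_real ?ger0_real //; apply/negP => lt.
  have [N hN] := ly (`|l| - r) (etrans (subr_gt0 _ _) lt).
  have := hN N (leqnn N); rewrite real_ltNge ?normr_real ?rpredB ?normr_real ?ger0_real //.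
  apply/negP; rewrite negbK; apply: (le_trans _ (lerB_dist _ _)).
  by rewrite lerD2l lerN2.
have lF : l = F l.
  apply/eqP; rewrite -subr_eq0; apply/eqP.
  apply: (@small_eq0 _ _ 2) => // e e0; have [N hN] := ly e e0.
  rewrite -{1}(subrK (y N.+1) l) -addrA.
  apply: le_trans (ler_normD _ _) _; rewrite mulr_natl mulr2n.
  apply: lerD; first exact/ltW/hN.
  rewrite /y iterS; apply: le_trans (Flip _ _ (yball N) lball) _.
  rewrite distrC; apply: (le_trans _ (ltW (hN N (leqnn N)))).
  by apply: ler_piMl => //; exact: ltW.

have ls : adj l = l.
  apply/eqP; rewrite -subr_eq0; apply/eqP.
  have ys n : adj (y n) = y n.
    elim: n => [|n IH]; first exact: adj0.
    by rewrite /y iterS /F adjZ adjD !adjM hs -/(y n) IH -[LHS]/(_^-1^* *: _) fmorphV rmorph_nat.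
  apply: (@small_eq0 _ _ 2) => // e e0; have [N hN] := ly e e0.
  rewrite -(subrK (y N) (adj l)) -addrA.
  apply: le_trans (ler_normD _ _) _; rewrite mulr_natl mulr2n.
  apply: lerD; last by rewrite distrC; exact/ltW/hN.
  by rewrite -{1}(ys N) -adjB norm_adj; exact/ltW/hN.
have lh : l ** h = h ** l.
  apply/eqP; rewrite -subr_eq0; apply/eqP.
  have yh n : y n ** h = h ** y n.
    elim: n => [|n IH]; first by rewrite /= cmul0l cmul0r.
    rewrite /y iterS /F -/(y n) cmulZl cmulZr; congr (_ *: _).
    have e2 : y n ** y n ** h = h ** (y n ** y n).
      by rewrite -cmulA IH cmulA IH cmulA.
    by rewrite cmulDl cmulDr -cmulA e2.
  apply: (@small_eq0 _ _ 2) => // e e0.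
  have h1' : 0 < `|h| + 1 by rewrite ltr_wpDl.
  have [N hN] := ly e e0.
  rewrite -(subrK (y N ** h) (l ** h)) {2}yh -addrA -cmulBl -cmulBr.
  apply: le_trans (ler_normD _ _) _; rewrite mulr_natl mulr2n.
  apply: lerD; apply: le_trans (normM_le _ _) _.
    by rewrite -[e]mulr1 ler_pM // ?ltW // hN.
  rewrite distrC -[e]mul1r ler_pM // ?ltW // ; exact: hN.
exists (cone A - l); split.
- by rewrite adjB adj_cone ls.
- by rewrite cmulBl cmulBr cmul1l cmul1r lh.
rewrite cmulBr cmul1r cmulBl cmul1l.
have : (2 : C) *: l = h ** h + l ** l.
  by rewrite {1}lF /F scalerA divff ?pnatr_eq0 // scale1r.
rewrite scaler_nat mulr2n => e2.
have -> : h ** h = l + l - l ** l by rewrite e2 addrK.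
by rewrite -(addrA (cone A)) -opprD (addrA l l) subrKC.
Qed.

End Sqrt.

Lemma star_hom_norm_le1 (A B : ucstarAlg R) (f : A -> B) (h : A) :
  is_star_hom f -> f (cone A) = cone B -> adj h = h -> `|h| < 1 -> `|f h| <= 1.
Proof.
case=> fL fM fs f1 hs h1; have [c [cs ch hc]] := sqrt_exists hs h1.
pose k := f h; pose d := f c.
have ks : adj k = k by rewrite -fs hs.
have ds : adj d = d by rewrite -fs cs.
have kd : d ** k = k ** d by rewrite -!fM ch.
have fD a b : f (a + b) = f a + f b by rewrite -[a]scale1r fL !scale1r.
have sq : k ** k + d ** d = cone B by rewrite -!fM -fD hc.
have iso (e : C) : e ^+ 2 = -1 -> e^* = - e -> `|k + e *: d| <= 1.
  move=> e2 ej; apply: isometry_norm_le1.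
  rewrite adjD adjZ ks ds ej cmulDl !cmulDr !cmulZl !cmulZr kd scalerA.
  rewrite mulNr -expr2 e2 opprK scale1r addrACA addrA addrC.
  by rewrite scaleNr subrK addrC sq.
have ii : ('i : C) ^+ 2 = -1 by rewrite sqrCi.
have p1 := iso 'i ii (conjCi _).
have p2 : `|k + (- 'i) *: d| <= 1.
  by apply: iso; rewrite ?sqrrN // rmorphN /= conjCi.
have e2 : (2 : C) *: k = (k + 'i *: d) + (k + (- 'i) *: d).
  by rewrite addrACA -scalerDl subrr scale0r addr0 scaler_nat mulr2n.
rewrite -(@ler_pM2l _ 2) // mulr1 -[X in X * _](@ger0_norm _ 2) // -normrZ e2.
by apply: le_trans (ler_normD _ _) _; rewrite -[2]/(1+1) lerD.
Qed.

Lemma star_hom_contractive (A B : ucstarAlg R) (f : A -> B) (a : A) :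
  is_star_hom f -> f (cone A) = cone B -> `|f a| <= `|a|.
Proof.
move=> fh f1; have [fL fM fs] := fh.
have fZ (c : C) b : f (c *: b) = c *: f b.
  have f0 : f 0 = 0 by have := fL (-1) 0 0; rewrite scaler0 addr0 scaleN1r addNr.
  by rewrite -[c *: b]addr0 fL f0 addr0.
suff sa h : adj h = h -> `|f h| <= `|h|.
  rewrite -(@ler_sqr _ `|f a|) ?nnegrE // -!normC -fs -fM; apply: sa.
  by rewrite adjM adjK.
move=> hs; rewrite real_leNgt ?normr_real //; apply/negP => lt.
pose t : C := (`|h| + `|f h|) / 2.
have [t1 t2] := midf_lt lt.
have t0 : 0 < t by apply: le_lt_trans t1.
have tn : `|t^-1| = t^-1 by rewrite ger0_norm // invr_ge0 ltW.
have := @star_hom_norm_le1 A B f (t^-1 *: h) fh f1.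
rewrite adjZ hs fZ !normrZ tn.
rewrite ler_pdivrMl // ltr_pdivrMl // mulr1 t1.
have -> : (t^-1)^* = t^-1 by apply: conj_Creal; rewrite realV gtr0_real.
by move=> /(_ erefl isT) le; have := lt_le_trans t2 le; rewrite ltxx.
Qed.

Lemma star_auto_isometric (A : ucstarAlg R) (f : A -> A) (a : A) :
  is_star_hom f -> bijective f -> `|f a| = `|a|.
Proof.
move=> fh [g fK gK]; have [fL fM fs] := fh.
have gh : is_star_hom g.
  split=> [c x y|x y|x]; apply: (can_inj fK); rewrite gK.
  - by rewrite fL !gK.
  - by rewrite fM !gK.
  - by rewrite fs gK.
have one (k k' : A -> A) : is_star_hom k -> cancel k' k -> k (cone A) = cone A.
  by case=> _ kM _ kK; rewrite -[RHS]kK -[k' _]cmul1l kM kK cmul1r.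
apply/eqP; rewrite eq_le (star_hom_contractive _ fh (one _ _ fh gK)) /=.
by rewrite -{1}(fK a) (star_hom_contractive _ gh (one _ _ gh fK)).
Qed.

End CstarTheory.
Section ModuleTheory.
Context {R : realType} {A : cstarAlg R}.

Lemma star_homD (B : cstarAlg R) (f : A -> B) a b :
  is_star_hom f -> f (a + b) = f a + f b.
Proof. by case=> fL _ _; rewrite -[a in LHS]scale1r fL scale1r. Qed.

Lemma star_hom0 (B : cstarAlg R) (f : A -> B) : is_star_hom f -> f 0 = 0.
Proof.
by move=> fh; apply: (addrI (f 0)); rewrite -(star_homD _ _ fh) !addr0.
Qed.

Lemma star_homZ (B : cstarAlg R) (f : A -> B) (c : R[i]) a :
  is_star_hom f -> f (c *: a) = c *: f a.
Proof.
by move=> fh; have [fL _ _] := fh; rewrite -[_ *: a]addr0 fL (star_hom0 fh) addr0.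
Qed.

Section Hilbert.
Variable E : hilbertModule A.
Implicit Types x y z : E.

Lemma innerDl x y z : inner (x + y) z = inner x z + inner y z.
Proof. by rewrite -adj_inner innerDr adjD !adj_inner. Qed.

Lemma innerZl (c : R[i]) x y : inner (c *: x) y = Num.conj c *: inner x y.
Proof. by rewrite -adj_inner innerZr adjZ adj_inner. Qed.

Lemma innerBr x y z : inner x (y - z) = inner x y - inner x z.
Proof. by rewrite innerDr -scaleN1r innerZr scaleN1r. Qed.

Lemma innerBl x y z : inner (x - y) z = inner x z - inner y z.
Proof. by rewrite -adj_inner innerBr adjB !adj_inner. Qed.

Lemma inner_eq0 x : inner x x = 0 -> x = 0.
Proof.
move=> h; have /eqP := norm_inner x; rewrite h normr0.
by rewrite expf_eq0 /= normr_eq0 => /eqP.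
Qed.

Lemma inner_ext x y : (forall z, inner x z = inner y z) -> x = y.
Proof.
move=> h; apply/eqP; rewrite -subr_eq0; apply/eqP/inner_eq0.
by rewrite innerBl h subrr.
Qed.

End Hilbert.

Lemma unitary_inner (E F : hilbertModule A) (M : E -> F) x y :
  is_unitary M -> inner (M x) (M y) = inner x y.
Proof. by case=> N [MN NM _]; rewrite MN NM. Qed.

Lemma unitary_linear (E F : hilbertModule A) (M : E -> F) :
  is_unitary M -> linear M.
Proof.
case=> N [MN _ _] c x y; apply: inner_ext => z.
by rewrite MN !(innerDl, innerZl) !MN.
Qed.

Lemma unitary_continuous (E F : hilbertModule A) (M : E -> F) :
  is_unitary M -> continuous M.
Proof.
move=> uM x; apply/cvgrPdist_lt => e e0; near=> y.
have -> : M x - M y = M (x - y).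
  by rewrite addrC -scaleN1r -unitary_linear // scaleN1r addrC.
have -> : `|M (x - y)| = `|x - y|.
  apply: (@pexpIrn _ 2); rewrite ?nnegrE //.
  by rewrite !norm_inner unitary_inner.
near: y; exact: (@cvgr_dist_lt _ _ _ _ _ id).
Unshelve. all: by end_near. Qed.

Lemma unitary_dense (E F : hilbertModule A) (M : E -> F) (S : set E) :
  is_unitary M -> dense (lin_span S) -> dense (lin_span (M @` S)).
Proof.
move=> uM dS O [v Ov] oO.
have [N [_ _ NM]] := uM.
have [||w [Ow [n [c [s [Ss wE]]]]]] := dS (M @^-1` O).
- by exists (N v); rewrite /= NM.
- by apply: open_comp => // x _; exact: unitary_continuous.
exists (M w); split=> //; exists n, c, (M \o s); split.
  by move=> k; exists (s k).
pose ML := GRing.isLinear.Build _ _ _ _ _ (unitary_linear uM).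
pose Ml : {linear E -> F} := HB.pack M ML.
rewrite wE -[M _]/(Ml _) linear_sum; apply: eq_bigr => k _.
by rewrite linearZ.
Qed.

End ModuleTheory.

Section ProductSystemTheory.
Context {R : realType} {P : monoidType} {A : cstarAlg R}.
Variable X : productSystem P A.

Lemma tot_inj p (x y : X p) : tot x = tot y -> x = y.
Proof.
by move=> h; have := projT2_eq h; rewrite (eq_irrelevance (projT1_eq h) erefl).
Qed.

Lemma tot_cast p q (x : X p) : p = q -> exists y : X q, tot y = tot x.
Proof. by case: q /; exists x. Qed.

Lemma psmul_tot p p' q q' (x : X p) (x' : X p') (y : X q) (y' : X q') :
  tot x = tot x' -> tot y = tot y' -> tot (psmul x y) = tot (psmul x' y').
Proof.
move=> hx hy.
pose f (s t : {p & X p}) := tot (psmul (projT2 s) (projT2 t)).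
by rewrite -[LHS]/(f (tot x) (tot y)) hx hy.
Qed.

Lemma psmul_linl p q (y : X q) : linear (fun x : X p => psmul x y).
Proof.
have [T [t [M [[tl _ _ _] uM Mt]]]] := psmul_unitary X p q.
by move=> c x x'; rewrite -!Mt tl unitary_linear.
Qed.

Lemma psmul_linr p q (x : X p) : linear (@psmul _ _ _ X p q x).
Proof.
have [T [t [M [[_ tr _ _] uM Mt]]]] := psmul_unitary X p q.
by move=> c y y'; rewrite -!Mt tr unitary_linear.
Qed.

Lemma psmul_inner p q (x x' : X p) (y y' : X q) :
  inner (psmul x y) (psmul x' y') = inner y (lact (inner x x') y').
Proof.
have [T [t [M [[_ _ ti _] uM Mt]]]] := psmul_unitary X p q.
by rewrite -!Mt unitary_inner.
Qed.

Lemma psmul_dense p q :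
  dense (lin_span [set z | exists (x : X p) (y : X q), z = psmul x y]).
Proof.
have [T [t [M [[_ _ _ td] uM Mt]]]] := psmul_unitary X p q.
have := unitary_dense uM td.
congr (dense (lin_span _)); apply/seteqP; split=> z /=.
  by case=> _ [x [y ->]] <-; exists x, y.
by case=> x [y ->]; exists (t x y) => //; exists x, y.
Qed.

End ProductSystemTheory.

Section ZsActionTheory.
Context {R : realType} {P : monoidType} {G : groupType} {D : zappaSzep P G}.
Context {A : cstarAlg R} {X : productSystem P A}.
Variable b : zsAction D X.

Lemma zbeta_tot g p q (x : X p) (y : X q) :
  tot x = tot y -> tot (zbeta b g x) = tot (zbeta b g y).
Proof.
pose f (s : {p & X p}) := tot (zbeta b g (projT2 s)).
by move=> h; rewrite -[LHS]/(f (tot x)) h.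
Qed.

Lemma zalphaM g h a : zalpha b g (zalpha b h a) = zalpha b (g * h)%g a.
Proof.
have [k kK _] := psid_bij X; apply: (can_inj kK); apply: tot_inj.
by rewrite -!zalphaE -zbetaM; apply: zbeta_tot; rewrite zalphaE.
Qed.

Lemma zalpha1 a : zalpha b 1%g a = a.
Proof.
have [k kK _] := psid_bij X; apply: (can_inj kK); apply: tot_inj.
by rewrite -zalphaE zbeta1.
Qed.

Lemma zalphaK g : cancel (zalpha b g) (zalpha b g^-1%g).
Proof. by move=> a; rewrite zalphaM mulVg zalpha1. Qed.

Lemma zalphaVK g : cancel (zalpha b g^-1%g) (zalpha b g).
Proof. by move=> a; rewrite zalphaM mulgV zalpha1. Qed.

Lemma zbeta_lact g p a (x : X p) :
  zbeta b g (lact a x) = lact (zalpha b g a) (zbeta b g x).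
Proof.
apply: tot_inj; rewrite -psmul_idl (zbeta_tot g (esym (psmul_idl a x))).
rewrite zbeta_psmul; apply: psmul_tot; first exact: zalphaE.
by rewrite zres_1.
Qed.

Lemma zbeta_surj g q (w : X (zact D g q)) : exists y : X q, zbeta b g y = w.
Proof.
have e : zact D g^-1%g (zact D g q) = q by rewrite -zactM mulVg zact1g.
have [y hy] := tot_cast (zbeta b g^-1%g w) e.
by exists y; apply: tot_inj; rewrite (zbeta_tot g hy) zbetaM mulgV zbeta1.
Qed.

End ZsActionTheory.

(* The fibre of X |><| G over (p, g) is carried by X_p, with [x : X_p] standing
   for x (x) g; its norm is that of X_p as beta_g is isometric on A. *)
Section BowtieProduct.
Context {R : realType} {P : monoidType} {G : groupType} {D : zappaSzep P G}.
Context {A : ucstarAlg R} {X : productSystem P A}.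
Variable b : zsAction D X.
Local Notation alpha := (zalpha b).

Section Fibre.
Variable s : bowtie D.

Definition bowtie_ract (x : X s.1) (a : A) : X s.1 := ract x (alpha s.2 a).
Definition bowtie_inner (x y : X s.1) : A := alpha s.2^-1%g (inner x y).

Let hom g := zalpha_hom b g.
Let homM g : {morph alpha g : a b / a ** b}.
Proof. by case: (hom g). Qed.
Let homC g : {morph alpha g : a / adj a}.
Proof. by case: (hom g). Qed.

Lemma bowtie_ractDl x y a :
  bowtie_ract (x + y) a = bowtie_ract x a + bowtie_ract y a.
Proof. exact: ractDl. Qed.

Lemma bowtie_ractDr x a c :
  bowtie_ract x (a + c) = bowtie_ract x a + bowtie_ract x c.
Proof. by rewrite /bowtie_ract star_homD // ractDr. Qed.

Lemma bowtie_ractZl (c : R[i]) x a :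
  bowtie_ract (c *: x) a = c *: bowtie_ract x a.
Proof. exact: ractZl. Qed.

Lemma bowtie_ractZr (c : R[i]) x a :
  bowtie_ract x (c *: a) = c *: bowtie_ract x a.
Proof. by rewrite /bowtie_ract star_homZ // ractZr. Qed.

Lemma bowtie_ractM x a c :
  bowtie_ract x (a ** c) = bowtie_ract (bowtie_ract x a) c.
Proof. by rewrite /bowtie_ract homM ractM. Qed.

Lemma bowtie_innerDr x y z :
  bowtie_inner x (y + z) = bowtie_inner x y + bowtie_inner x z.
Proof. by rewrite /bowtie_inner innerDr star_homD. Qed.

Lemma bowtie_innerZr (c : R[i]) x y :
  bowtie_inner x (c *: y) = c *: bowtie_inner x y.
Proof. by rewrite /bowtie_inner innerZr star_homZ. Qed.

Lemma bowtie_inner_ract x y a :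
  bowtie_inner x (bowtie_ract y a) = bowtie_inner x y ** a.
Proof. by rewrite /bowtie_inner /bowtie_ract inner_ract homM zalphaK. Qed.

Lemma bowtie_adj_inner x y : adj (bowtie_inner x y) = bowtie_inner y x.
Proof. by rewrite /bowtie_inner -homC adj_inner. Qed.

Lemma bowtie_inner_pos x : exists c : A, bowtie_inner x x = adj c ** c.
Proof.
have [c e] := inner_pos x; exists (alpha s.2^-1%g c).
by rewrite /bowtie_inner e homM homC.
Qed.

Lemma bowtie_norm_inner x : `|x| ^+ 2 = `|bowtie_inner x x|.
Proof.
rewrite norm_inner /bowtie_inner star_auto_isometric //; exact: zalpha_bij.
Qed.

Lemma bowtie_lact_adj a x y :
  bowtie_inner (lact a x) y = bowtie_inner x (lact (adj a) y).
Proof. by rewrite /bowtie_inner lact_adj. Qed.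

Definition bowtie_hilbert : hilbertModule A :=
  HilbertModule bowtie_ractDl bowtie_ractDr bowtie_ractZl bowtie_ractZr
    bowtie_ractM bowtie_innerDr bowtie_innerZr bowtie_inner_ract
    bowtie_adj_inner bowtie_inner_pos bowtie_norm_inner.

Definition bowtie_fibre : correspondence A :=
  @Correspondence R A bowtie_hilbert (@lact R A (X s.1))
    (@lactDl R A (X s.1)) (@lactDr R A (X s.1)) (@lactZl R A (X s.1))
    (@lactZr R A (X s.1)) (@lactM R A (X s.1)) bowtie_lact_adj.

End Fibre.

Definition bowtie_psmul (s t : bowtie D) (x : bowtie_fibre s)
    (y : bowtie_fibre t) : bowtie_fibre (s * t)%g :=
  psmul (x : X s.1) (zbeta b s.2 (y : X t.1)).

Lemma bowtie_tot (s t : bowtie D) (x : X s.1) (y : X t.1) :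
  s.2 = t.2 -> tot x = tot y ->
  tot (x : bowtie_fibre s) = tot (y : bowtie_fibre t).
Proof.
case: s t x y => [p g] [q h] /= x y <-.
pose f (u : {p & X p}) : {s & bowtie_fibre s} :=
  @tot _ _ _ bowtie_fibre (projT1 u, g) (projT2 u).
by move=> e; rewrite -[LHS]/(f (tot x)) e.
Qed.

Definition bowtie_psid (a : A) : bowtie_fibre 1%g := psid X a.

Lemma bowtie_psid_ract a c : bowtie_psid (a ** c) = ract (bowtie_psid a) c.
Proof. by rewrite /= /bowtie_ract zalpha1; exact: psid_ract. Qed.

Lemma bowtie_psid_inner a c :
  inner (bowtie_psid a) (bowtie_psid c) = adj a ** c.
Proof.
by rewrite /= /bowtie_inner /= invg1 zalpha1; exact: psid_inner.
Qed.

Lemma bowtie_psmulA (s t u : bowtie D) (x : bowtie_fibre s)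
    (y : bowtie_fibre t) (z : bowtie_fibre u) :
  tot (bowtie_psmul (bowtie_psmul x y) z) =
  tot (bowtie_psmul x (bowtie_psmul y z)).
Proof.
apply: bowtie_tot; first by rewrite mulgA.
rewrite /bowtie_psmul psmulA; apply: psmul_tot => //.
rewrite zbeta_psmul; apply: psmul_tot => //; exact/esym/zbetaM.
Qed.

Lemma bowtie_psmul_idl (s : bowtie D) a (x : bowtie_fibre s) :
  tot (bowtie_psmul (bowtie_psid a) x) = tot (lact a x).
Proof.
apply: bowtie_tot; first by rewrite mul1g.
rewrite /bowtie_psmul -psmul_idl; apply: psmul_tot => //; exact: zbeta1.
Qed.

Lemma bowtie_psmul_idr (s : bowtie D) a (x : bowtie_fibre s) :
  tot (bowtie_psmul x (bowtie_psid a)) = tot (ract x a).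
Proof.
apply: bowtie_tot; first by rewrite mulg1.
rewrite /bowtie_psmul /= /bowtie_ract -psmul_idr; apply: psmul_tot => //.
exact: zalphaE.
Qed.

Lemma bowtie_psmul_unitary (s t : bowtie D) :
  exists (T : hilbertModule A) (m : bowtie_fibre s -> bowtie_fibre t -> T)
         (M : T -> bowtie_fibre (s * t)%g),
    [/\ is_interior_tensor m, is_unitary M
      & forall x y, M (m x y) = bowtie_psmul x y].
Proof.
exists (bowtie_fibre (s * t)%g), (@bowtie_psmul s t), id; split=> //; last first.
  by exists id.
split.
- by move=> y; exact: psmul_linl.
- move=> x c y y'; rewrite /bowtie_psmul zbeta_linear; exact: psmul_linr.
- case: s t => [p g] [q h].
  have key (x x' : X p) (y y' : X q) :
      alpha (zres D g q * h)^-1%g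
        (inner (psmul x (zbeta b g y)) (psmul x' (zbeta b g y'))) =
      alpha h^-1%g (inner y (lact (alpha g^-1%g (inner x x')) y')).
    rewrite psmul_inner -[inner x x' in LHS](zalphaVK b g) -zbeta_lact.
    by rewrite zbeta_inner zalphaM invgM -mulgA mulVg mulg1.
  by move=> x y x' y'; exact: key.
- have := @psmul_dense _ _ _ X s.1 (zact D s.2 t.1).
  congr (dense (lin_span _)); apply/seteqP; split=> z /= [x [y ->]].
    by have [y' <-] := zbeta_surj b y; exists x, y'.
  by exists x, (zbeta b s.2 y).
Qed.

Definition bowtie_ps : productSystem (bowtie D) A :=
  @ProductSystem R (bowtie D) A bowtie_fibre bowtie_psmul bowtie_psid
    (@psid_linear R P A X) (@psid_bij R P A X) (@psid_lact R P A X)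
    bowtie_psid_ract bowtie_psid_inner bowtie_psmulA bowtie_psmul_unitary
    bowtie_psmul_idl bowtie_psmul_idr.

End BowtieProduct.

Section Universal.
Context {R : realType} {P : monoidType} {G : groupType} {D : zappaSzep P G}.

Record is_representation (A : cstarAlg R) (X : productSystem P A)
    (B : cstarAlg R) (psi : forall p : P, X p -> B) : Prop := {
  rep_linear : forall p, linear (psi p);
  rep_hom : is_star_hom (fun a => psi 1%g (psid X a));
  rep_mul : forall p q (x : X p) (y : X q),
    psi p x ** psi q y = psi (p * q)%g (psmul x y);
  rep_inner : forall p (x y : X p),
    adj (psi p x) ** psi p y = psi 1%g (psid X (inner x y)) }.

Record is_toeplitz (A : cstarAlg R) (X : productSystem P A)
    (T : cstarAlg R) (i : forall p : P, X p -> T) : Prop := {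
  toeplitz_rep : is_representation i;
  toeplitz_gen : generates [set t | exists p (x : X p), t = i p x];
  toeplitz_univ : forall (B : cstarAlg R) (psi : forall p : P, X p -> B),
    is_representation psi ->
    exists f : T -> B, is_star_hom f /\ forall p x, f (i p x) = psi p x }.

Definition is_unitary_rep (B : ucstarAlg R) (U : G -> B) : Prop :=
  [/\ U 1%g = cone B,
      forall g h, U (g * h)%g = U g ** U h,
      forall g, adj (U g) ** U g = cone B
    & forall g, U g ** adj (U g) = cone B].

Context {A : ucstarAlg R} {X : productSystem P A}.
Variable b : zsAction D X.

Record is_covariant (B : ucstarAlg R) (psi : forall p : P, X p -> B)
    (U : G -> B) : Prop := {
  cov_rep : is_representation psi;
  cov_unitary : is_unitary_rep U;
  cov_rel : forall g p (x : X p),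
    U g ** psi p x = psi (zact D g p) (zbeta b g x) ** U (zres D g p) }.

(* The universal C*-algebra of covariant representations is spanned by the
   products [psi p x ** U g], as for crossed products.  As [psi] is not
   required to be unital, generating by the [psi p x] and the [U g] separately
   would, for the universal pair, add a direct summand C*(G) on which [psi]
   vanishes; with the products, [iX 1 (psid X 1)] is the unit of [T], so that
   the [iG g] belong to the algebra generated. *)
Record is_toeplitz_bowtie (T : ucstarAlg R) (iX : forall p : P, X p -> T)
    (iG : G -> T) : Prop := {
  toeplitz_bowtie_cov : is_covariant iX iG;
  toeplitz_bowtie_gen :
    generates [set t | exists p (x : X p) g, t = iX p x ** iG g];
  toeplitz_bowtie_univ :
    forall (B : ucstarAlg R) (psi : forall p : P, X p -> B) (U : G -> B),
    is_covariant psi U ->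
    exists f : T -> B, is_star_hom f /\
      forall p x g, f (iX p x ** iG g) = psi p x ** U g }.

Record is_crossed_covariant (B : ucstarAlg R) (pi : A -> B) (V : G -> B)
    : Prop := {
  crossed_hom : is_star_hom pi;
  crossed_unitary : is_unitary_rep V;
  crossed_rel : forall g a, V g ** pi a = pi (zalpha b g a) ** V g }.

Record is_crossed_product (F : ucstarAlg R) (iA : A -> F) (u : G -> F)
    : Prop := {
  crossed_cov : is_crossed_covariant iA u;
  crossed_gen : generates [set t | exists a g, t = iA a ** u g];
  crossed_univ : forall (B : ucstarAlg R) (pi : A -> B) (V : G -> B),
    is_crossed_covariant pi V ->
    exists f : F -> B, is_star_hom f /\
      forall a g, f (iA a ** u g) = pi a ** V g }.

(* [j p x g] is the element x (x) g of Z_p.  Since Z_p is complete,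
   [tilde_inner] and [tilde_dense] say that it is the completion of c_00(G, X_p)
   for its F-valued inner product.  For a homogeneous action
   [zact D h p = p], and equality of points of the total space of Z is used to
   avoid casts along this equation. *)
Record is_tilde_product (F : ucstarAlg R) (iA : A -> F) (u : G -> F)
    (Z : productSystem P F) (j : forall p : P, X p -> G -> Z p) : Prop := {
  tilde_linear : forall p g, linear (fun x => j p x g);
  tilde_dense : forall p, dense (lin_span [set z | exists x g, z = j p x g]);
  tilde_lact : forall a h p (x : X p) g,
    tot (lact (iA a ** u h) (j p x g)) =
    tot (j (zact D h p) (lact a (zbeta b h x)) (zres D h p * g)%g);
  tilde_ract : forall p (x : X p) g a h,
    ract (j p x g) (iA a ** u h) = j p (ract x (zalpha b g a)) (g * h)%g;
  tilde_inner : forall p (x y : X p) g h,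
    inner (j p x g) (j p y h) =
    iA (zalpha b g^-1%g (inner x y)) ** u (g^-1 * h)%g;
  tilde_mul : forall p q (x : X p) (y : X q) g h,
    tot (psmul (j p x g) (j q y h)) =
    tot (j (p * zact D g q)%g (psmul x (zbeta b g y)) (zres D g q * h)%g);
  tilde_id : forall a g, psid Z (iA a ** u g) = j 1%g (psid X a) g }.

End Universal.

(* Main.v *)
Require Import Defs.
From HB Require Import structures.
From mathcomp Require Import all_boot all_order all_algebra.
From mathcomp Require Import complex ring.
From mathcomp Require Import all_classical all_reals all_analysis.
Set Implicit Arguments. Unset Strict Implicit. Unset Printing Implicit Defensive.
Import Order.TTheory GRing.Theory Num.Theory.
Import numFieldNormedType.Exports.
Local Open Scope classical_set_scope.
Local Open Scope ring_scope.

(** The three algebras are universal for the same data.  A representation [i] of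
X |><| G gives the covariant pair [x |-> i (x (x) e)], [g |-> i (1 (x) g)], and
a covariant pair [(psi, U)] gives the representation
[x (x) g |-> psi x ** U g] of X |><| G; likewise for X ~|><| G.  The universal
properties then yield mutually inverse maps, once the Toeplitz algebras are seen
to be unital, with unit the image of [1 : A].  The only analytic step is to
extend [x (x) g |-> psi x ** U g] from c_00(G, X_p) to its completion Z_p: it is
contractive because inner products are mapped through the *-homomorphism that
[(psi, U)] induces on the crossed product. *)

(** * Density arguments and extension of contractions in normed spaces *)

Section Approximation.
Context {R : realType}.
Local Notation C := R[i].

Lemma linear_packed (V W : lmodType C) (f : V -> W) :
  linear f -> exists F : {linear V -> W}, f = F.
Proof.
move=> fL; pose ML := GRing.isLinear.Build _ _ _ _ _ fL.
by pose F : {linear V -> W} := HB.pack f ML; exists F.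
Qed.

Lemma closed_approxP (V : normedModType C) (D : set V) :
  closed D <->
  (forall v, (forall e, 0 < e -> exists2 w, D w & `|v - w| < e) -> D v).
Proof.
split=> [cD v h|h v cv].
  apply: cD => B /nbhs_ballP [e /= e0 sB].
  have [w Dw vw] := h e e0; exists w; split=> //; apply: sB.
  by rewrite -ball_normE.
apply: h => e e0; have [|w [Dw]] := cv (ball v e); first exact: nbhsx_ballx.
by rewrite -ball_normE; exists w.
Qed.

Lemma dense_approx (V : normedModType C) (S : set V) v (e : C) :
  dense S -> 0 < e -> exists2 w, S w & `|v - w| < e.
Proof.
move=> dS e0.
have [||w [bw Sw]] := dS (ball v e); last by exists w; rewrite // -ball_normE in bw *.
- by exists v; exact: ballxx.
- exact: ball_open.
Qed.

(** The bound is existential because density arguments use only continuity; the crude constants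
    found below are therefore good enough. *)
Definition bounded_linear (V W : normedModType C) (f : V -> W) : Prop :=
  linear f /\ exists2 K : C, 0 <= K & forall v, `|f v| <= K * `|v|.

Lemma bounded_id (V : normedModType C) : bounded_linear (@id V).
Proof. by split=> //; exists 1 => // v; rewrite mul1r. Qed.

Lemma bounded_comp (V W Y : normedModType C) (g : W -> Y) (f : V -> W) :
  bounded_linear g -> bounded_linear f -> bounded_linear (g \o f).
Proof.
case=> gL [K K0 gK] [fL [L L0 fK]].
split=> [c x y|]; first by rewrite /= fL gL.
exists (K * L) => [|v]; first exact: mulr_ge0.
by apply: le_trans (gK _) _; rewrite -mulrA ler_wpM2l.
Qed.

(** If the maps agree at [w] near [v], their difference at [v] equals their difference at [v - w],
    which is at most [K + L] times the distance. *)
Lemma closed_eq_bounded (V W : normedModType C) (f g : V -> W) :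
  bounded_linear f -> bounded_linear g -> closed [set v | f v = g v].
Proof.
case=> /linear_packed [F ->] [K K0 fK] [/linear_packed [H ->] [L L0 hL]].
apply/closed_approxP => v h; apply/eqP; rewrite -subr_eq0; apply/eqP.
apply: (@small_eq0 _ _ _ (K + L)) => [|d d0]; first exact: addr_ge0.
have [w /= ew vw] := h d d0.
have -> : F v - H v = F (v - w) - H (v - w).
  by rewrite !linearB /= ew opprK addrACA addrC addNr add0r.
apply: le_trans (ler_normB _ _) _; rewrite mulrDl; apply: lerD.
  by apply: le_trans (fK _) _; rewrite ler_wpM2l // ltW.
by apply: le_trans (hL _) _; rewrite ler_wpM2l // ltW.
Qed.

(** Linearity carries the agreement from [S] to its span, and [closed_eq_bounded] to the closure.
    Identities on Z_p are thereby reduced to the elements x (x) g. *)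
Lemma bounded_linear_eq (V W : normedModType C) (f g : V -> W) (S : set V) :
  bounded_linear f -> bounded_linear g -> dense (lin_span S) ->
  (forall v, S v -> f v = g v) -> forall v, f v = g v.
Proof.
move=> bf bg dS e v.
apply: (closed_approxP _).1 (closed_eq_bounded bf bg) _ _ => d d0.
have [w [n [c [s [Ss wE]]]] vw] := dense_approx v dS d0.
exists w => //; case: bf bg => /linear_packed [F Ff] _ [/linear_packed [H Hg] _].
rewrite /= wE Ff Hg !linear_sum; apply: eq_bigr => k _.
by rewrite !linearZ -Ff -Hg e.
Qed.

Section Extension.
Variables (V : normedModType C) (W : completeNormedModType C) (K : Type).
Variables (a : K -> V) (b : K -> W).

(** A formal combination is a list, so that the same one can be evaluated in [V] and in [W].
    Independence of the chosen list comes from [le_ba]. *)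
Definition combination (U : lmodType C) (f : K -> U) (l : seq (C * K)) : U :=
  \sum_(x <- l) x.1 *: f x.2.

(** The list [l''] is chosen before [f], so one list serves both families [a] and [b]. *)
Lemma combination_linear (c : C) (l l' : seq (C * K)) :
  exists l'', forall (U : lmodType C) (f : K -> U),
    combination f l'' = c *: combination f l + combination f l'.
Proof.
exists ([seq (c * x.1, x.2) | x <- l] ++ l') => U f.
rewrite /combination big_cat big_map scaler_sumr; congr (_ + _).
by apply: eq_bigr => x _; rewrite scalerA.
Qed.

Hypothesis dense_a : dense (lin_span [set v | exists k, v = a k]).
Hypothesis le_ba : forall l, `|combination b l| <= `|combination a l|.

(** The closure of the graph [combination a l |-> combination b l]: a linear relation, single-valued
    because contractive, and total by density and by completeness of [W]. *)
Let related v w := forall e : C, 0 < e ->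
  exists l, `|v - combination a l| < e /\ `|w - combination b l| < e.

Let related_linear c v w v' w' :
  related v w -> related v' w' -> related (c *: v + v') (c *: w + w').
Proof.
move=> h h' e e0.
have c1 : 0 < `|c| + 1 by rewrite ltr_wpDl.
(* The tolerance is divided by |c| + 1 rather than |c| so as to cover [c = 0]. *)
have [l [hv hw]] := h (e / 2 / (`|c| + 1)) (divr_gt0 (divr_gt0 e0 (ltr0Sn _ 1)) c1).
have [l' [hv' hw']] := h' (e / 2) (divr_gt0 e0 (ltr0Sn _ 1)).
have [l'' E] := combination_linear c l l'.
have key (U : normedModType C) (x x' y y' : U) :
    `|x - y| < e / 2 / (`|c| + 1) -> `|x' - y'| < e / 2 ->
    `|c *: x + x' - (c *: y + y')| < e.
  move=> hx hx'; rewrite opprD addrACA -scalerBr.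
  apply: le_lt_trans (ler_normD _ _) _; rewrite [e]splitr; apply: ler_ltD => //.
  rewrite normrZ; apply: (@le_trans _ _ ((`|c| + 1) * `|x - y|)).
    by rewrite ler_wpM2r // lerDl.
  by move: hx; rewrite ltr_pdivlMr // mulrC => /ltW.
by exists l''; rewrite !E; split; apply: key.
Qed.

Let related_le v w : related v w -> `|w| <= `|v|.
Proof.
move=> h; apply/ler_addgt0Pr => e e0.
have [l [hv hw]] := h (e / 2) (divr_gt0 e0 (ltr0Sn _ 1)).
have hT : `|w| <= `|w - combination b l| + `|combination b l|.
  by rewrite -{1}(subrK (combination b l) w) ler_normD.
have hS : `|combination a l| <= `|v - combination a l| + `|v|.
  by rewrite -{1}(subrK v (combination a l)) distrC ler_normD.
apply: le_trans hT _; rewrite [e]splitr addrA [leRHS]addrC.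
apply: lerD (ltW hw) _; apply: le_trans (le_ba l) _; apply: le_trans hS _.
by rewrite [leLHS]addrC lerD2l ltW.
Qed.

Let related_combination l : related (combination a l) (combination b l).
Proof. by move=> e e0; exists l; rewrite !subrr !normr0. Qed.

(** Lists approximating [v] within 2^-n have values in [W] that form a Cauchy sequence; its limit is
    the partner of [v]. *)
Let related_ex v : exists w, related v w.
Proof.
have approx n : exists l, `|v - combination a l| < 2^-1 ^+ n :> C.
  have [|w [m [c [s [Ss ->]]]] vw] := @dense_approx _ _ v (2^-1 ^+ n) dense_a.
    by rewrite exprn_gt0 // invr_gt0.
  suff [l E] : exists l, \sum_(k < m) c k *: s k = combination a l.
    by exists l; rewrite -E.
  elim/big_ind : _ => [|x y [l ->] [l' ->]|k _].
  - by exists [::]; rewrite /combination big_nil.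
  - by exists (l ++ l'); rewrite /combination big_cat.
  - have [t ->] := Ss k.
    by exists [:: (c k, t)]; rewrite /combination big_seq1.
have [l hl] := choice approx.
pose y n := combination b (l n).
have small (e : C) : 0 < e -> exists N, forall n, (N <= n)%N -> 2^-1 ^+ n < e.
  apply: geometric_small; rewrite invr_ge0 ler0n /= invf_lt1 ?ltr1n //.
have ydist n m : `|y n - y m| <= 2^-1 ^+ n + 2^-1 ^+ m.
  (* [y n - y m] is the value of a single list, so [le_ba] transfers the estimate from [V]. *)
  have [l' E] := combination_linear (-1) (l m) (l n).
  rewrite /y addrC -scaleN1r -E; apply: le_trans (le_ba _) _; rewrite E.
  set x := combination a (l n); set z := combination a (l m).
  have -> : -1 *: z + x = (v - z) - (v - x).
    by rewrite scaleN1r opprB [RHS]addrC addrA subrK addrC.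
  apply: le_trans (ler_normB _ _) _; rewrite [leRHS]addrC.
  by apply: lerD; exact/ltW/hl.
have /cauchy_cvg yl : cauchy (y @ \oo).
  apply: cauchy_exP => _/posnumP[e].
  have [|N hN] := small (e%:num / 2); first by rewrite divr_gt0.
  exists (y N); exists N => // n /= le; rewrite -ball_normE /ball_ /=.
  apply: le_lt_trans (ydist _ _) _; rewrite [e%:num]splitr.
  by apply: ltrD; exact: hN.
exists (lim (y @ \oo)) => e e0.
have /cvgrPdist_lt/(_ e e0) [N _ hN] := yl.
have [M hM] := small e e0.
(* [M] brings the combination in [V] close to [v], and [N] brings [y] close to its limit. *)
exists (l (maxn N M)); split.
  by apply: lt_trans (hl _) _; apply: hM; exact: leq_maxr.
by apply: hN; exact: leq_maxl.
Qed.

(** The map is a choice function for [related]. Applying [related_le] to the difference of two pairs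
    over the same [v] gives uniqueness, hence linearity and the values on [a]. *)
Lemma extend_from_dense : exists f : V -> W,
  [/\ linear f, forall v, `|f v| <= `|v| & forall k, f (a k) = b k].
Proof.
have [f hf] := choice related_ex.
have uniq v w w' : related v w -> related v w' -> w = w'.
  move=> h h'; apply/eqP; rewrite -subr_eq0 -normr_le0.
  have := related_le (related_linear (-1) h' h).
  by rewrite !scaleN1r addNr normr0 addrC.
exists f; split=> [c v v'|v|k].
- by apply: uniq (hf _) _; apply: related_linear.
- exact: related_le.
apply: uniq (hf _) _.
by have := related_combination [:: (1, k)]; rewrite /combination !big_seq1 !scale1r.
Qed.

End Extension.

End Approximation.

(** * Norm estimates for inner products and for the left action *)

Section ModuleBounds.
Context {R : realType}.
Local Notation C := R[i].

Section Inner.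
Context {A : cstarAlg R} {E : hilbertModule A}.
Implicit Types x y z : E.

Lemma inner0l y : inner (0 : E) y = 0.
Proof. by rewrite -(subrr y) innerBl subrr. Qed.

Lemma inner0r y : inner y (0 : E) = 0.
Proof. by rewrite -(subrr y) innerBr subrr. Qed.

(** Expanding [inner (x + y) (x + y)] gives the bound 2 ^ 2 from this square, plus 1 + 1 from the
    squares of [x] and [y]. *)
Let inner_add_le x y : `|x| = 1 -> `|y| = 1 -> `|inner x y + inner y x| <= 6.
Proof.
move=> x1 y1.
have -> : inner x y + inner y x = inner (x + y) (x + y) - (inner x x + inner y y).
  rewrite innerDl !innerDr [inner y x + _]addrC addrACA.
  by rewrite [X in X - _]addrC addrK.
apply: le_trans (ler_normB _ _) _; rewrite (natrD _ 4 2) lerD //.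
  rewrite -norm_inner (natrX _ 2 2) lerXn2r ?nnegrE ?addr_ge0 //.
  by apply: le_trans (ler_normD _ _) _; rewrite x1 y1 -natr1.
by apply: le_trans (ler_normD _ _) _; rewrite -!norm_inner x1 y1 !expr1n.
Qed.

(* Polarization gives Cauchy-Schwarz with the constant 6; the sharp constant
   would require the order of [A]. *)
Lemma norm_inner_le x y : `|inner x y| <= 6 * (`|x| * `|y|).
Proof.
have [->|nx] := eqVneq x 0; first by rewrite inner0l !normr0 mul0r mulr0.
have [->|ny] := eqVneq y 0; first by rewrite inner0r !normr0 !mulr0.
have unit z : z != 0 -> exists2 z', `|z'| = 1 & z = `|z| *: z'.
  move=> nz; exists (`|z|^-1 *: z); last by rewrite scalerA divff ?normr_eq0 // scale1r.
  by rewrite normrZ normfV normr_id mulVf // normr_eq0.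
have [x' x1 ->] := unit x nx; have [y' y1 ->] := unit y ny.
rewrite innerZl innerZr !normrZ norm_conjC !normr_id x1 y1 !mulr1 mulrA mulrC.
rewrite ler_wpM2r ?mulr_ge0 //.
have h1 := inner_add_le x1 y1.
have yi1 : `|'i *: y'| = 1 by rewrite normrZ normCi mul1r.
have := inner_add_le x1 yi1.
rewrite innerZr innerZl conjCi scaleNr -scalerBr normrZ normCi mul1r => h2.
rewrite -(@ler_pM2l _ 2) // -[2 in leLHS]normr_nat -normrZ.
have -> : (2%:R : C) *: inner x' y' =
    (inner x' y' + inner y' x') + (inner x' y' - inner y' x').
  by rewrite addrACA subrr addr0 scaler_nat mulr2n.
by apply: le_trans (ler_normD _ _) _; rewrite mulr_natl mulr2n lerD.
Qed.

Lemma bounded_inner (z : E) :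
  bounded_linear (inner z).
Proof.
split=> [c x y|]; first by rewrite innerDr innerZr.
exists (6 * `|z|); first by rewrite mulr_ge0.
by move=> y; rewrite -mulrA norm_inner_le.
Qed.

Lemma inner_dense_eq0 (S : set E) z :
  dense (lin_span S) -> (forall y, S y -> inner z y = 0) -> z = 0.
Proof.
move=> dS h; apply: inner_ext => y; rewrite inner0l; move: y.
apply: (bounded_linear_eq (bounded_inner z) _ dS h).
by split=> [c x y|]; [rewrite scaler0 addr0|exists 0 => // y; rewrite normr0 mul0r].
Qed.

End Inner.

(** Unitality of the right action follows from [inner_ract]: both sides have the same inner product
    with every [z]. *)
Lemma ract_cone (A : ucstarAlg R) (E : hilbertModule A) (x : E) :
  ract x (cone A) = x.
Proof.
apply: inner_ext => z; rewrite -adj_inner inner_ract.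
by rewrite cmul1r adj_inner.
Qed.

(* For [|k| < 1], the two elements [k +- i c] with [k ** k + c ** c = 1] are
   unitary, hence act isometrically, and [k] is their average. *)
Lemma lact_selfadjoint_le (A : ucstarAlg R) (E : correspondence A) (h : A) (x : E) :
  lact (cone A) x = x -> adj h = h -> `|lact h x| <= 2 * `|h| * `|x|.
Proof.
move=> x1; suff small (k : A) : adj k = k -> `|k| < 1 -> `|lact k x| <= `|x|.
  move=> hs; have [->|nz] := eqVneq h 0.
    by rewrite -[0](scale0r 0) lactZl !scale0r !normr0 mulr0 mul0r.
  have t0 : 0 < 2 * `|h| by rewrite mulr_gt0 ?normr_gt0.
  have tn : `|(2 * `|h|)^-1| = (2 * `|h|)^-1 by rewrite ger0_norm // invr_ge0 ltW.
  (* The rescaled [h] has norm 1/2, strictly inside the unit ball; hence the factor 2 in the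
     bound. *)
  have := small ((2 * `|h|)^-1 *: h).
  rewrite Defs.adjZ hs lactZl !normrZ tn ler_pdivrMl // ltr_pdivrMl //.
  apply; last by rewrite mulr1 ltr_pMl ?normr_gt0 // ltr1n.
  by congr (_ *: _); apply: conj_Creal; rewrite realV gtr0_real.
move=> ks k1; have [c [cs ck kc]] := sqrt_exists ks k1.
have iso (e : C) : e ^+ 2 = -1 -> e^* = - e -> `|lact (k + e *: c) x| = `|x|.
  move=> e2 ej; apply: (@pexpIrn _ 2); rewrite ?nnegrE // !norm_inner.
  rewrite lact_adj -lactM; congr (`|inner x _|); rewrite -[RHS]x1; congr lact.
  rewrite adjD Defs.adjZ ks cs ej cmulDl !cmulDr !cmulZl !cmulZr ck scalerA.
  rewrite mulNr -expr2 e2 opprK scale1r addrACA addrA addrC.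
  by rewrite scaleNr subrK addrC kc.
have p1 := iso 'i (sqrCi _) (conjCi _).
have p2 : `|lact (k + (- 'i) *: c) x| = `|x|.
  by apply: iso; rewrite ?sqrrN ?sqrCi // rmorphN /= conjCi.
rewrite -(@ler_pM2l _ 2) // -[2 in leLHS]normr_nat -normrZ.
have -> : (2%:R : C) *: lact k x =
    lact (k + 'i *: c) x + lact (k + (- 'i) *: c) x.
  by rewrite -lactDl addrACA -scalerDl subrr scale0r addr0 lactDl scaler_nat mulr2n.
by apply: le_trans (ler_normD _ _) _; rewrite p1 p2 mulr_natl mulr2n.
Qed.

End ModuleBounds.

(** * Unitality and bounds in a product system *)

Section ProductSystemBounds.
Context {R : realType} {P : monoidType} {A : ucstarAlg R}.
Variable X : productSystem P A.

Lemma tot_inner p q (x y : X p) (x' y' : X q) :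
  tot x = tot x' -> tot y = tot y' -> inner x y = inner x' y'.
Proof.
move=> hx; have e := projT1_eq hx; rewrite /= in e.
by move: x' y' hx; case: q / e => x' y' /tot_inj -> /tot_inj ->.
Qed.

(* [x - lact 1 x] is orthogonal to all [lact a y], and these span a dense
   subspace of [X p] because the multiplication X_1 (x) X_p -> X_p is unitary. *)
Lemma lact_cone p (x : X p) : lact (cone A) x = x.
Proof.
apply/esym/eqP; rewrite -subr_eq0; apply/eqP.
set z := x - _.
(* [z] is moved to the fibre over [1 * p], where the products [psmul w y] live. *)
have [z' hz] := tot_cast z (esym (mul1g p)).
suff z0 : z' = 0.
  by apply: inner_eq0; rewrite -(tot_inner hz hz) z0 inner0l.
apply: (inner_dense_eq0 (@psmul_dense R P A X 1%g p)) => _ [w [y ->]].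
have [k _ kK] := psid_bij X; rewrite -(kK w).
rewrite (tot_inner hz (psmul_idl (k w) y)) /z innerBl.
by rewrite lact_adj -lactM adj_cone cmul1l subrr.
Qed.

(** The square of the left side is at most 6 * 2 = 12 times the square of |x||y|, by [norm_inner_le]
    and the bound for the action of the self-adjoint [inner x x]; and 12 <= 4 ^ 2. *)
Lemma norm_psmul_le p q (x : X p) (y : X q) :
  `|psmul x y| <= 4 * (`|x| * `|y|).
Proof.
rewrite -(@ler_sqr _ `|psmul x y|) ?nnegrE ?mulr_ge0 //.
rewrite norm_inner psmul_inner; apply: le_trans (norm_inner_le _ _) _.
have := @lact_selfadjoint_le R A (X q) (inner x x) y (lact_cone y) (adj_inner _ _).
rewrite -norm_inner => h.
have -> : (4 * (`|x| * `|y|)) ^+ 2 = 8 * (`|y| * (2 * `|x| ^+ 2 * `|y|)) :> R[i].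
  by ring.
apply: le_trans (_ : 6 * (`|y| * (2 * `|x| ^+ 2 * `|y|)) <= _).
  by rewrite ler_pM2l // ler_wpM2l.
by rewrite ler_wpM2r ?mulr_ge0 ?exprn_ge0 // ler_nat.
Qed.

Lemma norm_psid (a : A) : `|psid X a| = `|a|.
Proof.
apply: (@pexpIrn _ 2); rewrite ?nnegrE //.
by rewrite norm_inner psid_inner normC.
Qed.

End ProductSystemBounds.

(** * Star homomorphisms and units controlled on generators *)

Section Generators.
Context {R : realType}.
Local Notation C := R[i].

Lemma bounded_cmull (T : cstarAlg R) (a : T) : bounded_linear (cmul a).
Proof.
split=> [c x y|]; first by rewrite cmulDr cmulZr.
by exists `|a| => // v; exact: normM_le.
Qed.

Lemma bounded_cmulr (T : cstarAlg R) (a : T) : bounded_linear (fun t => t ** a).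
Proof.
split=> [c x y|]; first by rewrite /= cmulDl cmulZl.
by exists `|a| => // v; rewrite mulrC; exact: normM_le.
Qed.

Lemma bounded_star_hom (B T : ucstarAlg R) (f : B -> T) :
  is_star_hom f -> f (cone B) = cone T -> bounded_linear f.
Proof.
move=> fh f1; split; first by case: fh.
by exists 1 => // v; rewrite mul1r; exact: star_hom_contractive.
Qed.

(** The elements fixed by [e] on both sides form a C*-subalgebra; asking for both sides at once
    gives closure under the adjoint. *)
Lemma generates_unit (T : cstarAlg R) (S : set T) (e : T) :
  generates S -> adj e = e -> (forall s, S s -> e ** s = s /\ s ** e = s) ->
  left_id e (@cmul R T) /\ right_id e (@cmul R T).
Proof.
move=> gS es h.
have sub : is_cstar_sub ([set t | e ** t = t] `&` [set t | t ** e = t]).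
  split.
  - apply: closedI; apply: closed_eq_bounded (bounded_id _).
      exact: bounded_cmull.
    exact: bounded_cmulr.
  - by rewrite /= cmul0r cmul0l.
  - move=> c x y [ex xe] [ey ye].
    by split; rewrite /= ?(cmulDl, cmulDr) ?(cmulZl, cmulZr) ?ex ?ey ?xe ?ye.
  - by move=> x y [ex xe] [ey ye]; split; rewrite /= ?cmulA ?ex // -cmulA ye.
  - by move=> x [ex xe]; split; rewrite /= -{1}es -adjM ?xe ?ex.
have all t : ([set t | e ** t = t] `&` [set t | t ** e = t]) t.
  by rewrite (gS _ sub h).
by split=> t; case: (all t).
Qed.

(** The equalizer is a C*-subalgebra, closed because unital star homomorphisms are contractive. *)
Lemma star_hom_ext (B T : ucstarAlg R) (f g : B -> T) (S : set B) :
  is_star_hom f -> is_star_hom g -> f (cone B) = cone T -> g (cone B) = cone T ->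
  generates S -> (forall s, S s -> f s = g s) -> forall t, f t = g t.
Proof.
move=> fh gh f1 g1 gS e t.
have -> : f t = g t <-> [set t | f t = g t] t by [].
rewrite (gS [set t | f t = g t]) //; split.
- by apply: closed_eq_bounded; exact: bounded_star_hom.
- by rewrite /= !star_hom0.
- move=> c x y /= ex ey; case: fh gh => fL _ _ [gL _ _].
  by rewrite fL gL ex ey.
- by move=> x y /= ex ey; case: fh gh => _ fM _ [_ gM _]; rewrite fM gM ex ey.
- by move=> x /= ex; case: fh gh => _ _ fs [_ _ gs]; rewrite fs gs ex.
Qed.

Lemma star_hom_id (B : cstarAlg R) : is_star_hom (@id B).
Proof. by []. Qed.

Lemma star_hom_comp (B T U : cstarAlg R) (g : T -> U) (f : B -> T) :
  is_star_hom g -> is_star_hom f -> is_star_hom (g \o f).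
Proof.
case=> gL gM gs [fL fM fs].
by split=> [c x y|x y|x] /=; rewrite ?(fL, fM, fs) ?(gL, gM, gs).
Qed.

Lemma cstar_iso_generators (B T : ucstarAlg R) (S : set B) (S' : set T)
    (f : B -> T) (g : T -> B) :
  is_star_hom f -> is_star_hom g -> f (cone B) = cone T -> g (cone T) = cone B ->
  generates S -> generates S' ->
  (forall s, S s -> g (f s) = s) -> (forall s, S' s -> f (g s) = s) ->
  cstar_iso B T.
Proof.
move=> fh gh f1 g1 gS gS' gf fg; exists f; split=> //; exists g.
  apply: (star_hom_ext (star_hom_comp gh fh) (star_hom_id B) _ _ gS) => //=.
  by rewrite f1.
apply: (star_hom_ext (star_hom_comp fh gh) (star_hom_id T) _ _ gS') => //=.
by rewrite g1.
Qed.

Lemma star_hom_bij_cone (B T : ucstarAlg R) (f : B -> T) :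
  is_star_hom f -> bijective f -> f (cone B) = cone T.
Proof.
by case=> _ fM _ [g _ gK]; rewrite -[RHS]gK -[g _]cmul1l fM gK cmul1r.
Qed.

End Generators.

(** * Representations and the unit of a Toeplitz algebra *)

Section Representations.
Context {R : realType} {P : monoidType}.

(** Equality in the total space replaces casts between fibres over equal indices, and
    representations respect it. *)
Lemma rep_tot (A B : cstarAlg R) (X : productSystem P A)
    (psi : forall p, X p -> B) p q (x : X p) (y : X q) :
  tot x = tot y -> psi p x = psi q y.
Proof.
pose f (s : {p : P & X p}) := psi (projT1 s) (projT2 s).
by move=> e; rewrite -[LHS]/(f (tot x)) e.
Qed.

Lemma rep_lact (A B : cstarAlg R) (X : productSystem P A)
    (psi : forall p, X p -> B) p a (x : X p) :
  is_representation psi -> psi 1%g (psid X a) ** psi p x = psi p (lact a x).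
Proof. by move=> h; rewrite (rep_mul h); apply: rep_tot; exact: psmul_idl. Qed.

Lemma rep_ract (A B : cstarAlg R) (X : productSystem P A)
    (psi : forall p, X p -> B) p a (x : X p) :
  is_representation psi -> psi p x ** psi 1%g (psid X a) = psi p (ract x a).
Proof. by move=> h; rewrite (rep_mul h); apply: rep_tot; exact: psmul_idr. Qed.

Context {A : ucstarAlg R} {X : productSystem P A}.

Lemma rep_contractive (B : ucstarAlg R) (psi : forall p, X p -> B) p (x : X p) :
  is_representation psi -> psi 1%g (psid X (cone A)) = cone B ->
  `|psi p x| <= `|x|.
Proof.
move=> h h1; rewrite -(@ler_sqr _ `|psi p x|) ?nnegrE // -normC (rep_inner h).
by rewrite norm_inner; exact: star_hom_contractive (rep_hom h) h1.
Qed.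

Section ToeplitzUnit.
Context {T : cstarAlg R} {i : forall p, X p -> T} (ti : is_toeplitz i).

(** The unit of [A] acts trivially on both sides of every fibre, so its image fixes every
    generator. *)
Lemma toeplitz_unit : left_id (i (psid X (cone A))) (@cmul R T) /\
  right_id (i (psid X (cone A))) (@cmul R T).
Proof.
have ri := toeplitz_rep ti; have [_ _ hs] := rep_hom ri.
apply: generates_unit (toeplitz_gen ti) _ _; first by rewrite -hs adj_cone.
by move=> _ [p [x ->]]; rewrite rep_lact // rep_ract // lact_cone ract_cone.
Qed.

Definition toeplitz_unital : ucstarAlg R :=
  UcstarAlg toeplitz_unit.1 toeplitz_unit.2.

End ToeplitzUnit.

End Representations.

Section UnitaryReps.
Context {R : realType} {G : groupType} {B : ucstarAlg R} {U : G -> B}.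
Hypothesis hU : is_unitary_rep U.

Lemma adj_unitary g : adj (U g) = U g^-1%g.
Proof.
case: hU => U1 UM Us _.
by rewrite -[LHS]cmul1r -U1 -(mulgV g) UM cmulA Us cmul1l.
Qed.

End UnitaryReps.

(** * Covariant pairs and representations of X |><| G *)

Section ZappaSzepSystems.
Context {R : realType} {P : monoidType} {G : groupType} {D : zappaSzep P G}.
Context {A : ucstarAlg R} {X : productSystem P A} (b : zsAction D X).

Lemma zalpha_cone g : zalpha b g (cone A) = cone A.
Proof. exact: star_hom_bij_cone (zalpha_hom b g) (zalpha_bij b g). Qed.

Section Covariant.
Context {B : ucstarAlg R} {psi : forall p, X p -> B} {U : G -> B}.
Hypothesis cov : is_covariant b psi U.

Lemma covariant_coefficient g a :
  U g ** psi (psid X a) = psi (psid X (zalpha b g a)) ** U g.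
Proof.
rewrite (cov_rel cov) zres_1; congr (_ ** _).
by apply: rep_tot; exact: zalphaE.
Qed.

(** Moving [U g] past [psi y] by covariance reproduces the multiplication rule shared by X |><| G
    and X ~|><| G. *)
Lemma covariant_mul p q (x : X p) (y : X q) g h :
  (psi x ** U g) ** (psi y ** U h) =
  psi (psmul x (zbeta b g y)) ** U (zres D g q * h)%g.
Proof.
have [_ UM _ _] := cov_unitary cov.
rewrite UM -(rep_mul (cov_rep cov)) cmulA -[_ ** U g ** _]cmulA.
by rewrite (cov_rel cov) !cmulA.
Qed.

(** For [g = h] the right side comes from the inner product of X |><| G; for general [g] and [h] it
    matches the crossed-product-valued one of Z_p. *)
Lemma covariant_inner p (x y : X p) g h :
  adj (psi x ** U g) ** (psi y ** U h) =
  psi (psid X (zalpha b g^-1%g (inner x y))) ** U (g^-1 * h)%g.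
Proof.
have [_ UM _ _] := cov_unitary cov.
rewrite adjM (adj_unitary (cov_unitary cov)) cmulA -[_ ** psi y]cmulA.
by rewrite (rep_inner (cov_rep cov)) covariant_coefficient UM cmulA.
Qed.

Lemma covariant_bowtie_rep : @is_representation R (bowtie D) A (bowtie_ps b) B
  (fun s (x : bowtie_ps b s) => psi (x : X s.1) ** U s.2).
Proof.
have rpsi := cov_rep cov; have [U1 _ _ _] := cov_unitary cov.
split.
- by move=> s c x y; rewrite (rep_linear rpsi) cmulDl cmulZl.
- have -> : (fun a => (fun s (x : bowtie_ps b s) => psi (x : X s.1) ** U s.2)
      1%g (psid (bowtie_ps b) a)) = (fun a => psi (psid X a)).
    by apply: funext => a; rewrite /= U1 cmul1r.
  exact: rep_hom rpsi.
- by move=> [p g] [q h] x y; exact: covariant_mul.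
- by move=> [p g] x y /=; rewrite covariant_inner mulVg.
Qed.

End Covariant.

Section BowtieRep.
Context {B : ucstarAlg R} {i : forall s : bowtie D, bowtie_ps b s -> B}.
Hypothesis ri : is_representation i.
Hypothesis i1 : i (psid (bowtie_ps b) (cone A)) = cone B.

Let iP p (x : X p) : B := i (x : bowtie_ps b ((p, 1%g) : bowtie D)).
Let iG g : B := i (psid X (cone A) : bowtie_ps b ((1%g, g) : bowtie D)).

(** The result may be named in any convenient fibre: [z] and [k] match the product only up to
    provable equality of indices. *)
Lemma bowtie_rep_mul p g q h r k (x : X p) (y : X q) (z : X r) :
  tot (psmul x (zbeta b g y)) = tot z -> (zres D g q * h)%g = k ->
  i (x : bowtie_ps b ((p, g) : bowtie D)) **
  i (y : bowtie_ps b ((q, h) : bowtie D)) =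
  i (z : bowtie_ps b ((r, k) : bowtie D)).
Proof.
move=> e ek; rewrite (rep_mul ri); apply: rep_tot.
exact: (@bowtie_tot _ _ _ _ _ _ b (_ * _)%g ((r, k) : bowtie D)).
Qed.

Lemma bowtie_rep_split p g (x : X p) :
  iP x ** iG g = i (x : bowtie_ps b ((p, g) : bowtie D)).
Proof.
apply: bowtie_rep_mul; last by rewrite zres1g mul1g.
by rewrite (psmul_tot erefl (zbeta1 b _)) psmul_idr ract_cone.
Qed.

(** Both sides of the covariance relation are the image of beta_g(x) (x) g|_p: the left as the
    product of 1 (x) g and x (x) e, the right by [bowtie_rep_split]. *)
Lemma bowtie_rep_covariant : is_covariant b iP iG.
Proof.
have GM g h : iG (g * h)%g = iG g ** iG h.
  apply/esym/bowtie_rep_mul; last by rewrite zres_1.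
  by rewrite psmul_idl lact_cone zalphaE zalpha_cone.
have G1 : iG 1%g = cone B by [].
have GV g : adj (iG g) ** iG g = cone B.
  rewrite (rep_inner ri) /= /bowtie_inner psid_inner cmul1r adj_cone.
  by rewrite zalpha_cone.
split.
- split.
  + by move=> p c x y; exact: (rep_linear ri).
  + exact: rep_hom ri.
  + move=> p q x y; apply: bowtie_rep_mul; last by rewrite zres1g mul1g.
    exact: psmul_tot (zbeta1 b _).
  + by move=> p x y; rewrite (rep_inner ri) /= /bowtie_inner /= invg1 zalpha1.
(* Multiplicativity and the isometry relation already identify the adjoint with the value at the
   inverse, which gives the other unitarity relation. *)
- split=> // g; have -> : adj (iG g) = iG g^-1%g.
    by rewrite -[LHS]cmul1r -G1 -(mulgV g) GM cmulA GV cmul1l.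
  by rewrite -GM mulgV.
- move=> g p x.
  have -> : iG g ** iP x =
      i (zbeta b g x : bowtie_ps b ((zact D g p, zres D g p) : bowtie D)).
    apply: bowtie_rep_mul; last by rewrite mulg1.
    by rewrite psmul_idl lact_cone.
  by rewrite bowtie_rep_split.
Qed.

End BowtieRep.

(** The image of 1 fixes each generator on both sides, passing through [iG g] because [zalpha b g]
    is unital; so it is the unit of [T]. *)
Lemma toeplitz_bowtie_cone (T : ucstarAlg R) (iX : forall p, X p -> T)
    (iG : G -> T) :
  is_toeplitz_bowtie b iX iG -> iX 1%g (psid X (cone A)) = cone T.
Proof.
move=> tT; have cT := toeplitz_bowtie_cov tT; have rT := cov_rep cT.
have [_ _ hs] := rep_hom rT.
have [||l _] := generates_unit (toeplitz_bowtie_gen tT) (e := iX 1%g (psid X (cone A))).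
- by rewrite -hs adj_cone.
- move=> _ [p [x [g ->]]]; split.
    by rewrite cmulA rep_lact // lact_cone.
  rewrite -cmulA (covariant_coefficient cT) zalpha_cone cmulA.
  by rewrite rep_ract // ract_cone.
by rewrite -[LHS]cmul1r l.
Qed.

Lemma crossed_product_cone (F : ucstarAlg R) (iA : A -> F) (u : G -> F) :
  is_crossed_product b iA u -> iA (cone A) = cone F.
Proof.
move=> cF; have [[_ iM hs] _ rel] := crossed_cov cF.
have [||l _] := generates_unit (crossed_gen cF) (e := iA (cone A)).
- by rewrite -hs adj_cone.
- move=> _ [a [g ->]]; split; first by rewrite cmulA -iM cmul1l.
  by rewrite -cmulA rel zalpha_cone cmulA -iM cmul1r.
by rewrite -[LHS]cmul1r l.
Qed.

Lemma toeplitz_bowtie_iso (T1 : cstarAlg R)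
    (i1 : forall s : bowtie D, bowtie_ps b s -> T1)
    (T2 : ucstarAlg R) (iX : forall p : P, X p -> T2) (iG : G -> T2) :
  is_toeplitz i1 -> is_toeplitz_bowtie b iX iG -> cstar_iso T1 T2.
Proof.
move=> t1 t2; pose T1u := toeplitz_unital t1.
have r1 : @is_representation R (bowtie D) A (bowtie_ps b) T1u i1 := toeplitz_rep t1.
have c2 := toeplitz_bowtie_cov t2.
have [U1 _ _ _] := cov_unitary c2.
have [f [fh fE]] := toeplitz_univ t1 (covariant_bowtie_rep c2).
(* [erefl] applies because the unit of [T1u] is by definition the image of [cone A]. *)
have [g [gh gE]] := toeplitz_bowtie_univ t2 (bowtie_rep_covariant r1 erefl).
have fE' p k (x : X p) :
    f (i1 ((p, k) : bowtie D) x) = iX p x ** iG k by exact: fE.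
have gE' p k (x : X p) : g (iX p x ** iG k) = i1 ((p, k) : bowtie D) x.
  by rewrite gE; exact: bowtie_rep_split.
(* The unit of [T2] is itself a generator, so the formulas on generators show that [f] and [g] are
   unital. *)
have e2 : cone T2 = iX 1%g (psid X (cone A)) ** iG 1%g.
  by rewrite U1 cmul1r (toeplitz_bowtie_cone t2).
apply: (@cstar_iso_generators R T1u T2 _ _ f g fh gh _ _ (toeplitz_gen t1)
  (toeplitz_bowtie_gen t2)).
- by rewrite e2 -fE'.
- by rewrite e2 gE'.
- by move=> _ [[p k] [x ->]]; rewrite fE' gE'.
- by move=> _ [p [x [k ->]]]; rewrite gE' fE'.
Qed.

End ZappaSzepSystems.

(** * Continuity of multiplication and of representations *)

Section BoundedMaps.
Context {R : realType} {P : monoidType} {A : ucstarAlg R} {X : productSystem P A}.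

Lemma bounded_psmull p q (y : X q) : bounded_linear (fun x : X p => psmul x y).
Proof.
split; first exact: psmul_linl.
exists (4 * `|y|) => [|x]; first by rewrite mulr_ge0.
by rewrite -mulrA [`|y| * _]mulrC norm_psmul_le.
Qed.

Lemma bounded_psmulr p q (x : X p) : bounded_linear (fun y : X q => psmul x y).
Proof.
split; first exact: psmul_linr.
exists (4 * `|x|) => [|y]; first by rewrite mulr_ge0.
by rewrite -mulrA norm_psmul_le.
Qed.

Lemma bounded_rep (B : ucstarAlg R) (psi : forall p, X p -> B) p :
  is_representation psi -> psi 1%g (psid X (cone A)) = cone B ->
  bounded_linear (psi p).
Proof.
move=> h h1; split; first exact: rep_linear h p.
by exists 1 => // x; rewrite mul1r rep_contractive.
Qed.

End BoundedMaps.

(** * Covariant pairs and representations of X ~|><| G *)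

Section TildeProduct.
Context {R : realType} {P : monoidType} {G : groupType} {D : zappaSzep P G}.
Context {A : ucstarAlg R} {X : productSystem P A} {b : zsAction D X}.
Context {F : ucstarAlg R} {iA : A -> F} {u : G -> F}.
Context {Z : productSystem P F} {j : forall p : P, X p -> G -> Z p}.
Hypothesis cF : is_crossed_product b iA u.
Hypothesis tZ : is_tilde_product b iA u j.

Let u1 : u 1%g = cone F.
Proof. by case: (crossed_unitary (crossed_cov cF)). Qed.

Let iA1 : iA (cone A) = cone F := crossed_product_cone cF.

(** The module formulas for [j] concern products [iA a ** u g]; this puts [u g] in that form. *)
Let uE g : u g = iA (cone A) ** u g.
Proof. by rewrite iA1 cmul1l. Qed.

Lemma tilde_tot p q (x : X p) (y : X q) g h :
  tot x = tot y -> g = h -> tot (j x g) = tot (j y h).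
Proof.
move=> e <-; pose f (s : {p & X p}) := tot (j (projT2 s) g).
by rewrite -[LHS]/(f (tot x)) e.
Qed.

Section RestrictRep.
Context {B : ucstarAlg R} {i : forall p, Z p -> B}.
Hypothesis ri : is_representation i.
Hypothesis i1 : i (psid Z (cone F)) = cone B.

Lemma tilde_rep_split p (x : X p) g :
  i (j x 1%g) ** i (psid Z (u g)) = i (j x g).
Proof.
by rewrite (rep_ract _ _ ri) uE (tilde_ract tZ) zalpha1 ract_cone mul1g.
Qed.

(** The [u g] in the coefficient algebra supply the unitaries. The left action of [u g] on [j x 1]
    yields [j (zbeta b g x) (zres D g p)], which [tilde_rep_split] factors as covariance demands. *)
Lemma tilde_rep_covariant :
  is_covariant b (fun p x => i (@j p x 1%g)) (fun g => i (psid Z (u g))).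
Proof.
have [kL kM ks] := rep_hom ri.
have [_ uM us us'] := crossed_unitary (crossed_cov cF).
split.
- split.
  + by move=> p c x y; rewrite (tilde_linear tZ) (rep_linear ri).
  + have -> : (fun a => i (j (psid X a) 1%g)) = (fun f => i (psid Z f)) \o iA.
      by apply: funext => a /=; rewrite -(tilde_id tZ) u1 cmul1r.
    exact: star_hom_comp (rep_hom ri) (crossed_hom (crossed_cov cF)).
  + move=> p q x y; rewrite (rep_mul ri); apply: rep_tot; rewrite (tilde_mul tZ).
    apply: tilde_tot; last by rewrite zres1g mulg1.
    exact: psmul_tot (zbeta1 b _).
  + move=> p x y; rewrite (rep_inner ri) (tilde_inner tZ) (tilde_id tZ).
    by rewrite invg1 zalpha1 mulg1.
- split; first by rewrite u1.
  + by move=> g h; rewrite uM kM.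
  + by move=> g; rewrite -ks -kM us.
  + by move=> g; rewrite -ks -kM us'.
- move=> g p x; rewrite tilde_rep_split (rep_lact _ _ ri); apply: rep_tot.
  by rewrite uE (tilde_lact tZ) lact_cone mulg1.
Qed.

End RestrictRep.

Section ExtendRep.
Context {B : ucstarAlg R} {psi : forall p, X p -> B} {U : G -> B}.
Hypothesis cov : is_covariant b psi U.
Hypothesis psi1 : psi (psid X (cone A)) = cone B.

(** [psi1] makes [h] unital, hence contractive, since [cone F] is the generator
    [iA (cone A) ** u 1]. *)
Lemma covariant_crossed : exists h : F -> B,
  [/\ is_star_hom h, h (cone F) = cone B &
    forall a g, h (iA a ** u g) = psi (psid X a) ** U g].
Proof.
have cc : is_crossed_covariant b (fun a => psi (psid X a)) U.
  split; [exact: rep_hom (cov_rep cov)|exact: cov_unitary cov|].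
  by move=> g a; exact: covariant_coefficient.
have [h [hh hE]] := crossed_univ cF cc; exists h; split=> //.
have [U1 _ _ _] := cov_unitary cov.
by rewrite -iA1 -[iA _]cmul1r -u1 hE U1 cmul1r.
Qed.

Lemma tilde_extend_fibre p : exists f : Z p -> B,
  [/\ linear f, forall z, `|f z| <= `|z| & forall x g, f (j x g) = psi x ** U g].
Proof.
have [h [hh h1 hE]] := covariant_crossed; have [hL hM hs] := hh.
have [||f [fL fK fE]] := @extend_from_dense R (Z p) B (X p * G)%type
    (fun k => j k.1 k.2) (fun k => psi k.1 ** U k.2).
- have := tilde_dense tZ (p := p); congr (dense (lin_span _)).
  apply/seteqP; split=> z /=; first by case=> x [g ->]; exists (x, g).
  by case=> [[x g]] ->; exists x, g.
- set a := (fun k : X p * G => j k.1 k.2); set c := (fun k => _ ** _) => l.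
  (* Gram matrices correspond under [h], by sesquilinearity and induction on both lists; with
     [l1 = l2] the C*-identity turns this into the norm bound. *)
  have key l1 l2 : adj (combination c l1) ** combination c l2 =
      h (inner (combination a l1) (combination a l2)).
    elim: l1 => [|k l1 IH].
      by rewrite /combination !big_nil adj0 cmul0l inner0l (star_hom0 hh).
    rewrite /combination !big_cons -!/(combination _ _) innerDl innerZl hL -IH.
    rewrite adjD Defs.adjZ cmulDl cmulZl; congr (_ *: _ + _).
    elim: l2 {IH} => [|k' l2 IH].
      by rewrite /combination !big_nil cmul0r inner0r (star_hom0 hh).
    rewrite /combination !big_cons -!/(combination _ _) innerDr innerZr hL -IH.
    rewrite cmulDr cmulZr; congr (_ *: _ + _).
    by rewrite /a /c (covariant_inner cov) (tilde_inner tZ) hE.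
  rewrite -(@ler_sqr _ `|combination c l|) ?nnegrE // -normC key norm_inner.
  exact: star_hom_contractive.
by exists f; split=> // x g; exact: (fE (x, g)).
Qed.

(** The separately extended fibre maps fit together: each identity holds on the elements [j x g] and
    passes to [Z] by density, one variable at a time. *)
Lemma tilde_extend_rep : exists f : forall p, Z p -> B,
  is_representation f /\ forall p (x : X p) g, f p (j x g) = psi x ** U g.
Proof.
have [h [hh h1 hE]] := covariant_crossed; have [hL hM hs] := hh.
pose f p := projT1 (cid (tilde_extend_fibre p)).
have fP p : [/\ linear (f p), forall z, `|f p z| <= `|z|
    & forall x g, f p (j x g) = psi x ** U g].
  exact: projT2 (cid (tilde_extend_fibre p)).
have fE p (x : X p) g : f p (j x g) = psi x ** U g by case: (fP p).
have fb p : bounded_linear (f p).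
  by have [fL le _] := fP p; split=> //; exists 1 => // v; rewrite mul1r.
have hb : bounded_linear h by exact: bounded_star_hom.
have dense_eq q (V : normedModType R[i]) (m m' : Z q -> V) :
    bounded_linear m -> bounded_linear m' ->
    (forall x g, m (j x g) = m' (j x g)) -> forall z, m z = m' z.
  move=> bm bm' e; apply: bounded_linear_eq bm bm' (tilde_dense tZ (p := q)) _.
  by move=> _ [x [g ->]]; exact: e.
have fF a : f 1%g (psid Z a) = h a.
  have [k Kk kK] := psid_bij Z.
  (* The inverse [k] of [psid] is isometric, so [f] and [h] can be compared by density on the fibre
     over 1. *)
  suff e z : f 1%g z = (h \o k) z by rewrite e /= Kk.
  move: z; apply: (dense_eq) => [||x g]; first exact: fb.
    apply: bounded_comp hb _; split=> [c x y|].
      by apply: (can_inj Kk); rewrite kK psid_linear !kK.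
    by exists 1 => // v; rewrite mul1r -(norm_psid Z) kK.
  have [k' _ k'K] := psid_bij X; rewrite -(k'K x).
  by rewrite fE /= -(tilde_id tZ) Kk hE.
exists f; split=> //; split.
- by move=> p; case: (fb p).
- by have -> : (fun a => f 1%g (psid Z a)) = h by exact: funext.
- move=> p q z w; move: w.
  apply: (dense_eq) => [||y g'].
  + exact: bounded_comp (bounded_cmull _) (fb q).
  + exact: bounded_comp (fb _) (bounded_psmulr _ _).
  move: z; apply: (dense_eq) => [||x g].
  + exact: bounded_comp (bounded_cmulr _) (fb p).
  + exact: bounded_comp (fb _) (bounded_psmull _ _).
  by rewrite !fE (covariant_mul cov) (rep_tot f (tilde_mul tZ _ _ _ _)) fE.
(* The first variable is conjugate-linear, so density is used only in the second; taking adjoints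
   then exchanges the two. *)
- have half p (y : X p) g z : adj (f p (j y g)) ** f p z = h (inner (j y g) z).
    move: z; apply: (dense_eq) => [||x g'].
    + exact: bounded_comp (bounded_cmull _) (fb p).
    + exact: bounded_comp hb (bounded_inner _).
    by rewrite !fE (covariant_inner cov) (tilde_inner tZ) hE.
  move=> p z w; rewrite fF; move: w; apply: (dense_eq) => [||x g].
  + exact: bounded_comp (bounded_cmull _) (fb p).
  + exact: bounded_comp hb (bounded_inner _).
  by rewrite -[LHS]adjK adjM adjK half -hs adj_inner.
Qed.

End ExtendRep.

Lemma toeplitz_tilde_iso (T2 : ucstarAlg R) (iX : forall p : P, X p -> T2)
    (iG : G -> T2) (T3 : cstarAlg R) (i3 : forall p : P, Z p -> T3) :
  is_toeplitz_bowtie b iX iG -> is_toeplitz i3 -> cstar_iso T2 T3.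
Proof.
move=> t2 t3; pose T3u := toeplitz_unital t3.
have r3 : @is_representation R P F Z T3u i3 := toeplitz_rep t3.
have c2 := toeplitz_bowtie_cov t2; have e2 := toeplitz_bowtie_cone t2.
have [U1 _ _ _] := cov_unitary c2.
have c3 := @tilde_rep_covariant T3u i3 r3 erefl.
have [f [fh fE]] := toeplitz_bowtie_univ t2 c3.
have [rho [rrho rhoE]] := tilde_extend_rep c2 e2.
have [g [gh gE]] := toeplitz_univ t3 rrho.
have fE' p (x : X p) k : f (iX p x ** iG k) = i3 p (j x k).
  by rewrite fE; exact: (@tilde_rep_split T3u i3 r3).
have jE : j (psid X (cone A)) 1%g = psid Z (cone F).
  by rewrite -(tilde_id tZ) u1 cmul1r iA1.
have f1 : f (cone T2) = cone T3u.
  by rewrite -e2 -[iX _ _]cmul1r -U1 fE' jE.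
have rho1 : rho 1%g (psid Z (cone F)) = cone T2.
  by rewrite -jE rhoE U1 cmul1r.
apply: (@cstar_iso_generators R T2 T3u _ _ f g fh gh f1 _
  (toeplitz_bowtie_gen t2) (toeplitz_gen t3)).
- by rewrite [g _]gE.
- by move=> _ [p [x [k ->]]]; rewrite fE' gE rhoE.
(* The generators of [T3] come from all of [Z p], not only from the [j x k], so a last density
   argument is required. *)
- move=> _ [p [z ->]]; rewrite gE; move: z.
  apply: bounded_linear_eq (tilde_dense tZ (p := p)) _.
  + exact: bounded_comp (bounded_star_hom fh f1) (bounded_rep p rrho rho1).
  + exact: (@bounded_rep R P F Z T3u i3).
  by move=> _ [x [k ->]]; rewrite /= rhoE fE'.
Qed.

End TildeProduct.

Theorem corollary4p6 (R : realType) (P : monoidType) (G : groupType)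
    (D : zappaSzep P G) (A : ucstarAlg R) (X : productSystem P A)
    (b : zsAction D X) :
  (forall (T1 : cstarAlg R) (i1 : forall s : bowtie D, bowtie_ps b s -> T1)
          (T2 : ucstarAlg R) (iX : forall p : P, X p -> T2) (iG : G -> T2),
     is_toeplitz i1 -> is_toeplitz_bowtie b iX iG ->
     cstar_iso T1 T2)
  /\
  (homogeneous D ->
   forall (T1 : cstarAlg R) (i1 : forall s : bowtie D, bowtie_ps b s -> T1)
          (T2 : ucstarAlg R) (iX : forall p : P, X p -> T2) (iG : G -> T2)
          (F : ucstarAlg R) (iA : A -> F) (u : G -> F)
          (Z : productSystem P F) (j : forall p : P, X p -> G -> Z p)
          (T3 : cstarAlg R) (i3 : forall p : P, Z p -> T3),
     is_toeplitz i1 -> is_toeplitz_bowtie b iX iG ->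
     is_crossed_product b iA u -> is_tilde_product b iA u j ->
     is_toeplitz i3 ->
     cstar_iso T1 T2 /\ cstar_iso T2 T3).
Proof.
split=> [|_]; first by move=> T1 i1 T2 iX iG; exact: toeplitz_bowtie_iso.
move=> T1 i1 T2 iX iG F iA u Z j T3 i3 t1 t2 cF tZ t3; split.
  exact: toeplitz_bowtie_iso t1 t2.
exact: toeplitz_tilde_iso cF tZ _ _ _ _ _ t2 t3.
Qed.
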